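(* Let $\{\bar{\mathscr{M}}(t)\}_{t\ge0}$, with components $M_i(G_i(t))$, $i=1,\dots,q$, be the multivariate generalized counting process time-changed by an independent multivariate gamma subordinator, with parameters $q$, $k_i$, $\lambda_{ij_i}$, $\lambda$, $\theta$, $a_i$ as in the context. Then for all $\bar u=(u_1,\dots,u_q)$ with $|u_i|\le1$, $i=1,\dots,q$, and all $t\ge0$, its probability generating function is $$\mathbb{E}\Big(\prod_{i=1}^{q}u_i^{M_i(G_i(t))}\Big)=\Bigg( \frac{1-\theta}{ \prod_{i=1}^{q}\big(1+\sum_{j_i=1}^{k_i}\frac{\lambda_{ij_i}}{a_i}(1-u_i^{j_i})\big)-\theta}\Bigg)^{\lambda t}.$$
   Context: Multivariate GCP: let $q\in\mathbb{N}$, $k_1,\dots,k_q\in\mathbb{N}$ and $\lambda_{ij_i}>0$ for $1\le i\le q$, $1\le j_i\le k_i$. $\bar M(t)=(M_1(t),\dots,M_q(t))$ has independent components, where $\{M_i(t)\}_{t\ge0}$ is a generalized counting process (GCP): the Lévy process started at $0$ performing independent jumps of sizes $j_i=1,\dots,k_i$ with rates $\lambda_{ij_i}$; equivalently $\mathbb{E}(u^{M_i(t)})=\exp\big(-t\sum_{j_i=1}^{k_i}\lambda_{ij_i}(1-u^{j_i})\big)$, $|u|\le1$. Multivariate gamma subordinator: let $\lambda>0$, $0<\theta<1$, $a_1,\dots,a_q>0$. $\{Z_i(t)\}_{t\ge0}$ are gamma Lévy processes with $Z_i(t)\sim\Gamma(\lambda t,a_i)$ (shape $\lambda t$, rate $a_i$),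 $\{B^-(\lambda t)\}_{t\ge0}$ is a negative binomial Lévy process with $\Pr\{B^-(\lambda t)=n\}=(1-\theta)^{\lambda t}\binom{n+\lambda t-1}{n}\theta^n$, $n\ge0$, and $Z_1,\dots,Z_q,B^-$ are mutually independent. $\bar G(t)=(G_1(t),\dots,G_q(t))$ with $G_i(t)=Z_i(t+\lambda^{-1}B^-(\lambda t))$. Time-changed process: $\{\bar M(t)\}$ and $\{\bar G(t)\}$ are independent and $\bar{\mathscr{M}}(t)=(\mathscr{M}_1(t),\dots,\mathscr{M}_q(t))$ with $\mathscr{M}_i(t)=M_i(G_i(t))$. Conventions: $0^0=1$. For complex $\bar u$ the power $w(\bar u)^{\lambda t}$ of the fraction $w(\bar u)$ on the right means $\exp(\lambda t\,L(\bar u))$, where $L$ is the continuous logarithm of $w$ on the closed unit polydisc with $L(1,\dots,1)=0$; for real $\bar u$ the fraction is positive and this is the ordinary real power. *)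

(* Defs.v *)
From HB Require Import structures.
From mathcomp Require Import all_boot all_order all_algebra.
From mathcomp Require Import complex.
From mathcomp Require Import all_classical all_reals all_analysis.
Set Implicit Arguments.
Unset Strict Implicit.
Unset Printing Implicit Defensive.
Import Order.TTheory GRing.Theory Num.Theory.
Import numFieldNormedType.Exports.
Local Open Scope classical_set_scope.
Local Open Scope ring_scope.
Local Open Scope complex_scope.

(** * Independence *)

Definition independent_pair (R : realType) (d : measure_display)
    (T : measurableType d) (P : probability T R) (F G : set (set T)) : Prop :=
  forall A B, F A -> G B -> P (A `&` B) = (P A * P B)%E.

Definition mutually_independent (R : realType) (d : measure_display)
    (T : measurableType d) (P : probability T R) (I : finType)
    (F : I -> set (set T)) : Prop :=
  forall (J : {set I}) (A : I -> set T), (forall i, i \in J -> F i (A i)) ->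
    P (\bigcap_(i in [set` J]) A i) = (\prod_(i in J) P (A i))%E.

(** Processes have type [R -> T -> R] (time, then outcome); only times
    [0 <= t] are constrained. *)

Definition sigma_rv (R : realType) (d : measure_display)
    (T : measurableType d) (X : T -> R) : set (set T) :=
  preimage_set_system setT X measurable.

Definition sigma_process (R : realType) (d : measure_display)
    (T : measurableType d) (X : R -> T -> R) : set (set T) :=
  <<s [set A | exists2 t : R, 0 <= t & sigma_rv (X t) A] >>.

Definition sigma_processes (R : realType) (d : measure_display)
    (T : measurableType d) (I : Type) (X : I -> R -> T -> R) : set (set T) :=
  <<s [set A | exists i, exists2 t : R, 0 <= t & sigma_rv (X i t) A] >>.

Definition real_process (R : realType) (T : Type) (N : R -> T -> nat) :
    R -> T -> R :=
  fun t w => (N t w)%:R.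

(** * Lévy processes *)

Definition cadlag (R : realType) (x : R -> R) : Prop :=
  (forall t : R, 0 <= t -> x s @[s --> t^'+] --> x t) /\
  (forall t : R, 0 < t -> cvg (x s @[s --> t^'-])).

Definition levy_process (R : realType) (d : measure_display)
    (T : measurableType d) (P : probability T R) (X : R -> T -> R) : Prop :=
  [/\ forall t : R, 0 <= t -> measurable_fun setT (X t),
      {ae P, forall w, X 0 w = 0} /\ {ae P, forall w, cadlag (X ^~ w)},
      forall (n : nat) (t : nat -> R), 0 <= t 0%N ->
        (forall j, (j < n)%N -> t j <= t j.+1) ->
        mutually_independent P
          (fun j : 'I_n => sigma_rv (fun w => X (t j.+1) w - X (t j) w)),
      forall (s t : R) (A : set R), 0 <= s -> s <= t -> measurable A ->
        P [set w | A (X t w - X s w)] = P [set w | A (X (t - s) w)] &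
      forall (t e : R), 0 <= t -> 0 < e ->
        P [set w | e <= `|X s w - X t w|]
          @[s --> within [set s | 0 <= s] (nbhs t)] --> 0%E].

(** Generalized counting process: a Lévy process with jumps of sizes
    [1, ..., k] only, the jump of size [j.+1] occurring at rate [lam j], i.e.
    P(N(h) = j+1) = lam j * h + o(h) and P(N(h) > k) = o(h) as h -> 0+. *)
Definition generalized_counting_process (R : realType) (d : measure_display)
    (T : measurableType d) (P : probability T R) (k : nat) (lam : 'I_k -> R)
    (N : R -> T -> nat) : Prop :=
  [/\ levy_process P (real_process N),
      forall j : 'I_k,
        fine (P [set w | N h w = j.+1]) / h @[h --> 0^'+] --> lam j &
      fine (P [set w | (k < N h w)%N]) / h @[h --> 0^'+] --> (0 : R)].

(** * Gamma and negative binomial processes *)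

Definition gamma_function (R : realType) (s : R) : R :=
  \int[lebesgue_measure]_(x in `]0, +oo[) (x `^ (s - 1) * expR (- x)).

(** [s] is the shape, [r] the rate. *)
Definition gamma_pdf (R : realType) (s r x : R) : R :=
  if 0 < x then
    r `^ s * x `^ (s - 1) * expR (- (r * x)) / gamma_function s
  else 0.

(** At [t = 0] the shape vanishes and the law is the Dirac mass at 0, which is
    part of [levy_process]. *)
Definition gamma_process (R : realType) (d : measure_display)
    (T : measurableType d) (P : probability T R) (lambda r : R)
    (Z : R -> T -> R) : Prop :=
  levy_process P Z /\
  forall (t : R) (A : set R), 0 < t -> measurable A ->
    P (Z t @^-1` A) =
      (\int[lebesgue_measure]_(x in A) (gamma_pdf (lambda * t) r x)%:E)%E.

Definition gbinom (R : realType) (x : R) (n : nat) : R :=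
  (\prod_(i < n) (x - i%:R)) / (n`!)%:R.

Definition negative_binomial_process (R : realType) (d : measure_display)
    (T : measurableType d) (P : probability T R) (theta : R)
    (B : R -> T -> nat) : Prop :=
  levy_process P (real_process B) /\
  forall (s : R) (n : nat), 0 <= s ->
    P [set w | B s w = n] =
      ((1 - theta) `^ s * gbinom (n%:R + s - 1) n * theta ^+ n)%:E.

Definition gamma_subordinator (R : realType) (T : Type) (I : Type)
    (lambda : R) (Z : I -> R -> T -> R) (B : R -> T -> nat) :
    I -> R -> T -> R :=
  fun i t w => Z i (t + lambda^-1 * (B (lambda * t) w)%:R) w.

(** * Complex expectation, exponential and powers *)

(** Since paths are càdlàg almost surely only, a time-changed process is a random
    variable up to a null set; the integral of a bounded function does not
    depend on its values on a null set. *)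
Definition cexpectation (R : realType) (d : measure_display)
    (T : measurableType d) (P : probability T R) (X : T -> R[i]) : R[i] :=
  fine 'E_P[fun w => complex.Re (X w)] +i* fine 'E_P[fun w => complex.Im (X w)].

Definition cexp (R : realType) (z : R[i]) : R[i] :=
  (expR (complex.Re z))%:C * (cos (complex.Im z) +i* sin (complex.Im z)).

Definition polydisc (R : realType) (q : nat) : set 'rV[R[i]]_q :=
  [set u | forall i, `|u 0 i| <= 1].

(** [L] is the continuous logarithm of [w] on the closed polydisc normalized at
    (1, ..., 1).  The alias [R[i]^o] carries the topology of the modulus, and
    the row vectors the product topology. *)
Definition continuous_log (R : realType) (q : nat)
    (w L : 'rV[R[i]]_q -> R[i]) : Prop :=
  [/\ {within (@polydisc R q : set 'rV[R[i]^o]_q),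
         continuous (L : 'rV[R[i]^o]_q -> R[i]^o)},
      forall u, polydisc u -> cexp (L u) = w u &
      L (const_mx 1) = 0].

Definition pgf_base (R : realType) (q : nat) (k : 'I_q -> nat)
    (lam : forall i : 'I_q, 'I_(k i) -> R) (theta : R) (a : 'I_q -> R)
    (u : 'rV[R[i]]_q) : R[i] :=
  (1 - theta%:C) /
  (\prod_(i < q)
     (1 + \sum_(j < k i) (lam i j / a i)%:C * (1 - u 0 i ^+ j.+1)) -
   theta%:C).

(* Main.v *)
(* Conditioning on the subordinator turns E prod_i u_i^(M_i(G_i)) into
   E prod_i exp(- c_i G_i) with c_i = sum_j lam_ij (1 - u_i^j): approximate G_i
   strictly from the right by grid-valued variables and use the right continuity
   of the paths.  Conditioning on B then gives
     F(lambda t, u) = prod_i g_i(t) * E z^(B(lambda t)),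
   where g_i(s) = E exp(- c_i Z_i(s)) and z = prod_i g_i(1 / lambda).  Every factor
   is a multiplicative semigroup in time, so neither the Laplace transform of a
   general gamma law at a complex point nor the negative binomial series is needed:
   at lambda t = 1 the laws of Z_i and B are exponential and geometric, and F(1, u)
   is the fraction w(u).  The quotient r(s, u) = F(s, u) exp(- s L(u)) is again a
   semigroup in s, with r(1, u) = 1 and r(s, (1, ..., 1)) = 1; since r(2^-(n+1), u)
   is a square root of r(2^-n, u) depending continuously on u along the segment from
   (1, ..., 1) to u, r equals 1 at dyadic times, and at all times by continuity
   at 0. *)

Require Import Defs.
From HB Require Import structures.
From mathcomp Require Import all_boot all_order all_algebra.
From mathcomp Require Import complex.
From mathcomp Require Import all_classical all_reals all_analysis.
From mathcomp Require Import measurable_realfun.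
From mathcomp Require Import ring lra.
Import Order.TTheory GRing.Theory Num.Theory.
Import numFieldNormedType.Exports.
Local Open Scope classical_set_scope.
Local Open Scope ring_scope.
Local Open Scope complex_scope.
Set Implicit Arguments.
Unset Strict Implicit.
Unset Printing Implicit Defensive.

(** * Complex numbers *)

(** Two obstacles shape the proof. First, [M i (G i t w) w] is a random variable only up to a null
    set, so expectations have to be compared for integrands known only almost everywhere;
    measurability is recovered by writing the variable, off a null set, as a pointwise limit of
    measurable ones. Second, conditioning is only ever on countable-valued variables: [B], or the
    subordinator rounded to a grid. An expectation is split over the cells, and on each cell the
    indicator is one more factor in a product of independent variables. Hence joint laws on product
    spaces and measurability in time and outcome jointly never enter. Rounding also yields the
    exponential law: a rounded exponential variable is geometric, so a finite geometric sum is the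
    only transform computed by hand. The generating function of a counting process comes from its
    rates alone, by comparing two contraction semigroups with the same derivative at 0. All
    integrands are bounded, so each passage to the limit is dominated convergence with a constant
    bound. *)

Local Notation nc := ComplexField.Normc.normc.

Section complex_norm.
Context {R : realType}.
Implicit Types z w : R[i].

Lemma norm_nc z : `|z| = (nc z)%:C. Proof. by []. Qed.

Lemma nc_ge0 z : 0 <= nc z.
Proof. by case: z => a b; exact: sqrtr_ge0. Qed.

Lemma ncM z w : nc (z * w) = nc z * nc w.
Proof. exact: ComplexField.Normc.normcM. Qed.

Lemma nc1 : nc (1 : R[i]) = 1.
Proof. exact: ComplexField.Normc.normc1. Qed.

Lemma nc0 : nc (0 : R[i]) = 0.
Proof. exact: ComplexField.Normc.normc0. Qed.

Lemma ncX z n : nc (z ^+ n) = nc z ^+ n.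
Proof. by elim: n => [|n IH]; rewrite ?expr0 ?nc1// !exprS ncM IH. Qed.

Lemma nc_prod (I : Type) (r : seq I) (P : pred I) (F : I -> R[i]) :
  nc (\prod_(i <- r | P i) F i) = \prod_(i <- r | P i) nc (F i).
Proof. by apply: big_morph; [exact: ncM|exact: nc1]. Qed.

Lemma nc_real (x : R) : nc x%:C = `|x|.
Proof. by rewrite /= expr0n addr0 sqrtr_sqr. Qed.

Lemma ler_ncD z w : nc (z + w) <= nc z + nc w.
Proof. by rewrite -lecR rmorphD/= -!norm_nc ler_normD. Qed.

Lemma ncN z : nc (- z) = nc z.
Proof. by apply: complexI; rewrite -!norm_nc normrN. Qed.

Lemma nc_distC z w : nc (z - w) = nc (w - z).
Proof. by rewrite -ncN opprB. Qed.

Lemma nc_eq0 z : (nc z == 0) = (z == 0).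
Proof.
apply/eqP/eqP => [/ComplexField.Normc.eq0_normc//|->]; exact: nc0.
Qed.

Lemma ler_Re_nc z : `|complex.Re z| <= nc z.
Proof.
by case: z => a b /=; rewrite -sqrtr_sqr ler_wsqrtr// lerDl sqr_ge0.
Qed.

Lemma ler_Im_nc z : `|complex.Im z| <= nc z.
Proof.
by case: z => a b /=; rewrite -sqrtr_sqr ler_wsqrtr// lerDr sqr_ge0.
Qed.

Lemma ler_nc_ReIm z : nc z <= `|complex.Re z| + `|complex.Im z|.
Proof.
rewrite {1}(complexE z) (le_trans (ler_ncD _ _))// ncM !nc_real.
by rewrite (_ : nc 'i%C = 1) ?mul1r//= expr0n expr1n add0r sqrtr1.
Qed.

Lemma sqr_nc z : nc z ^+ 2 = complex.Re z ^+ 2 + complex.Im z ^+ 2.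
Proof. by case: z => a b /=; rewrite sqr_sqrtr// addr_ge0 ?sqr_ge0. Qed.

Lemma ReCD z w : complex.Re (z + w) = complex.Re z + complex.Re w.
Proof. by case: z w => ? ? [? ?]. Qed.

Lemma ImCD z w : complex.Im (z + w) = complex.Im z + complex.Im w.
Proof. by case: z w => ? ? [? ?]. Qed.

Lemma ReCM z w : complex.Re (z * w) =
  complex.Re z * complex.Re w - complex.Im z * complex.Im w.
Proof. by case: z w => ? ? [? ?]. Qed.

Lemma ImCM z w : complex.Im (z * w) =
  complex.Re z * complex.Im w + complex.Im z * complex.Re w.
Proof. by case: z w => ? ? [? ?]. Qed.

Lemma ReCN z : complex.Re (- z) = - complex.Re z.
Proof. by case: z. Qed.

Lemma ImCN z : complex.Im (- z) = - complex.Im z.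
Proof. by case: z. Qed.

Lemma ReCB z w : complex.Re (z - w) = complex.Re z - complex.Re w.
Proof. by rewrite ReCD ReCN. Qed.

Lemma ImCB z w : complex.Im (z - w) = complex.Im z - complex.Im w.
Proof. by rewrite ImCD ImCN. Qed.

Lemma Re_sum (I : Type) (r : seq I) (P : pred I) (F : I -> R[i]) :
  complex.Re (\sum_(i <- r | P i) F i) = \sum_(i <- r | P i) complex.Re (F i).
Proof. by apply: big_morph => //; exact: ReCD. Qed.

Lemma eq_ReIm z w : complex.Re z = complex.Re w -> complex.Im z = complex.Im w ->
  z = w.
Proof. by case: z w => ? ? [? ?] /= -> ->. Qed.

Lemma prod_nc_le1 (I : Type) (r : seq I) (P : pred I) (F : I -> R[i]) :
  (forall i, P i -> nc (F i) <= 1) -> nc (\prod_(i <- r | P i) F i) <= 1.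
Proof.
move=> F1; apply: (big_ind (fun z => nc z <= 1)) => //; first by rewrite nc1.
by move=> x y x1 y1; rewrite ncM mulr_ile1 ?nc_ge0.
Qed.

Lemma nc_exp_le1 z n : nc z <= 1 -> nc (z ^+ n) <= 1.
Proof. by move=> z1; rewrite ncX exprn_ile1// nc_ge0. Qed.

(** Telescoping of contractions. With [n] the number of steps that subdivide a time interval, it
    turns agreement of two semigroups up to o(h) at one step h into equality at a fixed time. *)
Lemma ler_nc_subX z w n : nc z <= 1 -> nc w <= 1 ->
  nc (z ^+ n - w ^+ n) <= n%:R * nc (z - w).
Proof.
move=> z1 w1; elim: n => [|n IH]; first by rewrite !expr0 subrr nc0 mul0r.
rewrite !exprS (_ : _ - _ = z * (z ^+ n - w ^+ n) + (z - w) * w ^+ n).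
  rewrite (le_trans (ler_ncD _ _))// !ncM -natr1 mulrDl mul1r lerD//.
    by rewrite (le_trans _ IH)// ler_piMl// nc_ge0.
  by rewrite ler_piMr ?nc_ge0// nc_exp_le1.
by rewrite mulrBr mulrBl addrA subrK.
Qed.

(** Working on real and imaginary parts gives direct access to real limits and integrals; [ccvgP]
    identifies this convergence with that of the modulus topology used by [continuous_log]. *)
Definition ccvg (U : Type) (F : set_system U) (f : U -> R[i]) (l : R[i]) :=
  complex.Re (f x) @[x --> F] --> complex.Re l /\
  complex.Im (f x) @[x --> F] --> complex.Im l.

Section ccvg.
Context (U : Type) (F : set_system U) {FF : Filter F}.
Implicit Types (f g : U -> R[i]) (l m : R[i]).

Lemma ccvgP f l : ccvg F f l <-> (f : U -> R[i]^o) x @[x --> F] --> (l : R[i]^o).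
Proof.
split=> [[/cvgrPdist_lt rel /cvgrPdist_lt iml]|/cvgrPdist_lt fl]; last first.
  split; apply/cvgrPdist_lt => e e0.
    have /fl : 0 < (e%:C : R[i]) by rewrite ltcR.
    apply: filterS => x; rewrite norm_nc ltcR; apply: le_lt_trans.
    by rewrite -ReCB ler_Re_nc.
  have /fl : 0 < (e%:C : R[i]) by rewrite ltcR.
  apply: filterS => x; rewrite norm_nc ltcR; apply: le_lt_trans.
  by rewrite -ImCB ler_Im_nc.
(* In the partial order of [R[i]] a positive radius has zero imaginary part. *)
apply/cvgrPdist_lt => -[e e']; rewrite ltcE/= => /andP[/eqP -> e0].
have e20 : 0 < e / 2 by rewrite divr_gt0.
apply: filterS2 (rel _ e20) (iml _ e20) => x re im.
rewrite norm_nc (_ : e +i* 0 = e%:C)// ltcR (le_lt_trans (ler_nc_ReIm _))//.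
by rewrite (splitr e) ltrD ?ReCB ?ImCB.
Qed.

Lemma ccvg_nc f l : ccvg F f l <-> nc (f x - l) @[x --> F] --> (0 : R).
Proof.
split=> [[/cvgrPdist_lt rel /cvgrPdist_lt iml]|/cvgrPdist_lt fl].
  apply/cvgrPdist_lt => e e0; have e20 : 0 < e / 2 by rewrite divr_gt0.
  apply: filterS2 (rel _ e20) (iml _ e20) => x re im.
  rewrite sub0r normrN ger0_norm ?nc_ge0// nc_distC.
  by rewrite (le_lt_trans (ler_nc_ReIm _))// (splitr e) ltrD ?ReCB ?ImCB.
split; apply/cvgrPdist_lt => e /fl; apply: filterS => x;
  rewrite sub0r normrN ger0_norm ?nc_ge0// nc_distC; apply: le_lt_trans.
- by rewrite -ReCB ler_Re_nc.
- by rewrite -ImCB ler_Im_nc.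
Qed.

Lemma ccvg_cst l : ccvg F (fun=> l) l.
Proof. by split; exact: cvg_cst. Qed.

Lemma ccvgD f g l m : ccvg F f l -> ccvg F g m ->
  ccvg F (fun x => f x + g x) (l + m).
Proof.
move=> [fr fi] [gr gi]; split.
  by rewrite ReCD; under eq_fun do rewrite ReCD; exact: cvgD.
by rewrite ImCD; under eq_fun do rewrite ImCD; exact: cvgD.
Qed.

Lemma ccvgN f l : ccvg F f l -> ccvg F (fun x => - f x) (- l).
Proof.
move=> [fr fi]; split.
  by rewrite ReCN; under eq_fun do rewrite ReCN; exact: cvgN.
by rewrite ImCN; under eq_fun do rewrite ImCN; exact: cvgN.
Qed.

Lemma ccvgB f g l m : ccvg F f l -> ccvg F g m ->
  ccvg F (fun x => f x - g x) (l - m).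
Proof. by move=> fl gm; apply: ccvgD => //; exact: ccvgN. Qed.

Lemma ccvgM f g l m : ccvg F f l -> ccvg F g m ->
  ccvg F (fun x => f x * g x) (l * m).
Proof.
move=> [fr fi] [gr gi]; split.
  rewrite ReCM; under eq_fun do rewrite ReCM.
  by apply: cvgB; exact: cvgM.
rewrite ImCM; under eq_fun do rewrite ImCM.
by apply: cvgD; exact: cvgM.
Qed.

Lemma ccvg_prod (I : Type) (r : seq I) (f : I -> U -> R[i]) (l : I -> R[i]) :
  (forall i, ccvg F (f i) (l i)) ->
  ccvg F (fun x => \prod_(i <- r) f i x) (\prod_(i <- r) l i).
Proof.
move=> fl; elim: r => [|i r IH].
  by under eq_fun do rewrite big_nil; rewrite big_nil; exact: ccvg_cst.
by under eq_fun do rewrite big_cons; rewrite big_cons; exact: ccvgM.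
Qed.

Lemma ccvg_sum (I : Type) (r : seq I) (f : I -> U -> R[i]) (l : I -> R[i]) :
  (forall i, ccvg F (f i) (l i)) ->
  ccvg F (fun x => \sum_(i <- r) f i x) (\sum_(i <- r) l i).
Proof.
move=> fl; elim: r => [|i r IH].
  by under eq_fun do rewrite big_nil; rewrite big_nil; exact: ccvg_cst.
by under eq_fun do rewrite big_cons; rewrite big_cons; exact: ccvgD.
Qed.

Lemma ccvgX f l n : ccvg F f l -> ccvg F (fun x => f x ^+ n) (l ^+ n).
Proof.
move=> fl; elim: n => [|n IH].
  by under eq_fun do rewrite expr0; rewrite expr0; exact: ccvg_cst.
by under eq_fun do rewrite exprS; rewrite exprS; exact: ccvgM.
Qed.

Lemma ccvg_real (f : U -> R) (l : R) :
  f x @[x --> F] --> l -> ccvg F (fun x => (f x)%:C) l%:C.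
Proof. by move=> fl; split => //=; exact: cvg_cst. Qed.

Lemma ccvg_unique {PF : ProperFilter F} f l m : ccvg F f l -> ccvg F f m -> l = m.
Proof.
move=> [rl il] [rm im]; apply: eq_ReIm.
  exact: (cvg_unique _ rl rm).
exact: (cvg_unique _ il im).
Qed.

End ccvg.

End complex_norm.

Lemma nc_subr_le0 (R : realType) (z w : R[i]) : nc (z - w) <= 0 -> z = w.
Proof.
move=> zw; apply/eqP; rewrite -subr_eq0 -nc_eq0.
by rewrite eq_le zw nc_ge0.
Qed.

Lemma ccvg_near (R : realType) (U : Type) (F : set_system U) {FF : Filter F}
    (f : U -> R[i]) l : (\forall x \near F, f x = l) -> ccvg F f l.
Proof.
by move=> fl; split; apply: cvg_near_cst; apply: filterS fl => x ->.
Qed.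

Lemma ccvg_near_eq (R : realType) (U : Type) (F : set_system U) {FF : Filter F}
    (f g : U -> R[i]) l : (\forall x \near F, f x = g x) -> ccvg F f l -> ccvg F g l.
Proof.
move=> fg [fr fi]; split.
  by apply: cvg_trans fr; apply: near_eq_cvg; apply: filterS fg => x ->.
by apply: cvg_trans fi; apply: near_eq_cvg; apply: filterS fg => x ->.
Qed.

Lemma ccvg_at_right_seq (R : realType) (f : R -> R[i]) (l : R[i]) (h : nat -> R) :
  ccvg (0 : R)^'+ f l -> (forall n, 0 < h n) -> h n @[n --> \oo] --> (0 : R) ->
  ccvg \oo (fun n => f (h n)) l.
Proof.
by move=> [/cvg_at_rightP fr /cvg_at_rightP fi] hp h0; split; [exact: fr|exact: fi].
Qed.

(** * The complex exponential *)

Section cexp.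
Context {R : realType}.
Implicit Types z w : R[i].

Lemma Re_cexp z : complex.Re (cexp z) = expR (complex.Re z) * cos (complex.Im z).
Proof. by case: z => a b; rewrite /cexp /= mul0r subr0. Qed.

Lemma Im_cexp z : complex.Im (cexp z) = expR (complex.Re z) * sin (complex.Im z).
Proof. by case: z => a b; rewrite /cexp /= mul0r addr0. Qed.

Lemma cexpD z w : cexp (z + w) = cexp z * cexp w.
Proof.
apply: eq_ReIm.
  by rewrite Re_cexp [RHS]ReCM !Re_cexp !Im_cexp !ReCD !ImCD expRD cosD; ring.
by rewrite Im_cexp [RHS]ImCM !Re_cexp !Im_cexp !ReCD !ImCD expRD sinD; ring.
Qed.

Lemma cexp0 : cexp (0 : R[i]) = 1.
Proof.
by apply: eq_ReIm; rewrite ?Re_cexp ?Im_cexp /= expR0 ?cos0 ?sin0 ?mulr1 ?mulr0.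
Qed.

Lemma cexp_real (x : R) : cexp (x%:C) = (expR x)%:C.
Proof.
by apply: eq_ReIm; rewrite ?Re_cexp ?Im_cexp /= ?cos0 ?sin0 ?mulr1 ?mulr0.
Qed.

Lemma nc_cexp z : nc (cexp z) = expR (complex.Re z).
Proof.
apply/eqP; rewrite -(@eqrXn2 _ 2) ?nc_ge0 ?expR_ge0// sqr_nc.
by rewrite Re_cexp Im_cexp !exprMn -mulrDr cos2Dsin2 mulr1.
Qed.

Lemma cexp_neq0 z : cexp z != 0.
Proof. by rewrite -nc_eq0 nc_cexp gt_eqF// expR_gt0. Qed.

Lemma cexpN z : cexp (- z) = (cexp z)^-1.
Proof.
apply: (mulfI (cexp_neq0 z)); rewrite -cexpD subrr cexp0 divff//.
exact: cexp_neq0.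
Qed.

Lemma cexpB z w : cexp (z - w) = cexp z / cexp w.
Proof. by rewrite cexpD cexpN. Qed.

Lemma cexp_sum (I : Type) (r : seq I) (P : pred I) (F : I -> R[i]) :
  cexp (\sum_(i <- r | P i) F i) = \prod_(i <- r | P i) cexp (F i).
Proof. exact: (big_morph _ cexpD cexp0). Qed.

Lemma cexpMn z n : cexp (z *+ n) = cexp z ^+ n.
Proof.
by elim: n => [|n IH]; rewrite ?mulr0n ?cexp0// mulrS cexpD IH exprS.
Qed.

Lemma ccvg_cexp (U : Type) (F : set_system U) {FF : Filter F}
    (f : U -> R[i]) (l : R[i]) :
  ccvg F f l -> ccvg F (fun x => cexp (f x)) (cexp l).
Proof.
move=> [rel iml]; split.
- rewrite Re_cexp; under eq_fun do rewrite Re_cexp.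
  apply: cvgM; apply: continuous_cvg => //.
    exact: continuous_expR.
  exact: continuous_cos.
- rewrite Im_cexp; under eq_fun do rewrite Im_cexp.
  apply: cvgM; apply: continuous_cvg => //.
    exact: continuous_expR.
  exact: continuous_sin.
Qed.

(** The right derivative at 0 of the exponential semigroup. It serves twice: in the comparison with
    the jump rates, and to rescale the geometric identity when a grid is refined. *)
Lemma cexp_derive0 (c : R[i]) :
  ccvg (0 : R)^'+ (fun h : R => (cexp (h%:C * c) - 1) * (h^-1)%:C) c.
Proof.
case: c => a b.
pose fr (h : R) := expR (a * h) * cos (b * h).
pose fi (h : R) := expR (a * h) * sin (b * h).
have dr : is_derive (0 : R) 1 fr a.
  apply: is_derive_eq.
  by rewrite !mulr0 expR0 cos0 sin0 /GRing.scale/=; ring.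
have di : is_derive (0 : R) 1 fi b.
  apply: is_derive_eq.
  by rewrite !mulr0 expR0 cos0 sin0 /GRing.scale/=; ring.
have key (f : R -> R) l : is_derive (0 : R) 1 f l ->
    (f h - f 0) * h^-1 @[h --> (0:R)^'+] --> l.
  move=> [df vf]; have : h^-1 *: ((f \o shift 0) (h *: 1) - f 0) @[h --> (0:R)^'+] --> l.
    rewrite -vf; apply: cvg_trans df; apply: cvg_app.
    by move=> A [e e0 eA]; exists e => // y ye y0; apply: eA => //; rewrite gt_eqF.
  by apply: cvg_trans; apply: near_eq_cvg; near=> h;
    rewrite /= addr0 /GRing.scale/= mulr1 mulrC.
split.
- have := key _ _ dr; apply: cvg_trans; apply: near_eq_cvg; near=> h.
  rewrite ReCM ReCB Re_cexp !ReCM !ImCM /= /fr !mulr0 expR0 cos0.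
  by rewrite !mul0r !subr0 !addr0 mulr1 (mulrC a) (mulrC b).
- have := key _ _ di; apply: cvg_trans; apply: near_eq_cvg; near=> h.
  rewrite ImCM ImCB Im_cexp !ReCM !ImCM /= /fi !mulr0 expR0 sin0.
  by rewrite !mul0r mulr0 !subr0 add0r addr0 (mulrC a) (mulrC b).
Unshelve. all: by end_near.
Qed.

End cexp.

(** * Complex expectations *)

Section integral_ae.
Context (R : realType) (d : measure_display) (T : measurableType d).
Variable mu : {measure set T -> \bar R}.
Import HBNNSimple.
Local Open Scope ereal_scope.

(* The library compares integrals of almost everywhere equal functions for
   measurable functions only. *)
Lemma le_ereal_sup_sintegral_ae (f g : T -> \bar R) (N : set T) :
  measurable N -> mu N = 0 -> (forall x, 0 <= g x) ->
  (forall x, ~ N x -> f x = g x) ->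
  ereal_sup [set sintegral mu h |
    h in [set h : {nnsfun T >-> R} | forall x, (h x)%:E <= f x]] <=
  ereal_sup [set sintegral mu h |
    h in [set h : {nnsfun T >-> R} | forall x, (h x)%:E <= g x]].
Proof.
(* Cutting [h] off on [N] keeps its integral, since [N] is null, and puts it below [g] everywhere:
   on [N] the cut function is 0 and [g] is nonnegative. *)
move=> mN N0 g0 fg; apply: ge_ereal_sup => _ [h hf <-].
have mNC : measurable (~` N) by exact: measurableC.
have -> : sintegral mu h = sintegral mu (proj_nnsfun h mNC).
  have sE (k : {nnsfun T >-> R}) : sintegral mu k = \int[mu]_x (k x)%:E.
    by rewrite integral_nnsfun// patch_setT.
  rewrite !sE; apply: ae_eq_integral => //.
  - by apply/measurable_EFinP; exact: measurable_funPT.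
  - by apply/measurable_EFinP; exact: measurable_funPT.
  - exists N; split => // x /= /not_implyP[_ hx]; apply: contrapT => Nx; apply: hx.
    by rewrite mindicE mem_set// mulr1.
apply: ereal_sup_ubound; exists (proj_nnsfun h mNC) => //= x.
rewrite mindicE; have [/set_mem Nx|_] := boolP (x \in ~` N).
  by rewrite mulr1 -(fg _ Nx).
by rewrite mulr0.
Qed.

(** The argument stays with the definition of the integral as a difference of suprema over simple
    functions, so it reaches integrands such as the time-changed product, whose measurability is
    known only up to a null set. *)
Lemma integral_ae_eq (f g : T -> \bar R) :
  {ae mu, forall x, f x = g x} -> \int[mu]_x f x = \int[mu]_x g x.
Proof.
move=> [N [mN N0 fgN]].
have fg x : ~ N x -> f x = g x.
  by move=> Nx; apply: contrapT => fgx; apply: Nx; exact: fgN.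
by rewrite /integral !patch_setT; congr (_ - _); apply/eqP;
  rewrite eq_le; apply/andP; split; apply: (le_ereal_sup_sintegral_ae mN N0) => // x Nx;
  rewrite ?funeposE ?funenegE fg.
Qed.

End integral_ae.

Section cexpectation.
Context (R : realType) (d : measure_display) (T : measurableType d).
Variable P : probability T R.
Implicit Types X Y : T -> R[i].

(** The working class of integrands: integrable under a probability and closed under ring
    operations, so a single side condition covers linearity, products and limits. It is also applied
    to functions on the real line. *)
Definition bmeas X := [/\ measurable_fun setT (fun w => complex.Re (X w)),
  measurable_fun setT (fun w => complex.Im (X w)) &
  exists c, forall w, nc (X w) <= c].

Lemma bmeas_cst z : bmeas (fun=> z).
Proof. by split; [exact: measurable_cst..|exists (nc z)]. Qed.

Lemma bmeasD X Y : bmeas X -> bmeas Y -> bmeas (fun w => X w + Y w).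
Proof.
move=> [xr xi [c xc]] [yr yi [c' yc]]; split.
- by under eq_fun do rewrite ReCD; exact: measurable_funD.
- by under eq_fun do rewrite ImCD; exact: measurable_funD.
- by exists (c + c') => w; rewrite (le_trans (ler_ncD _ _))// lerD.
Qed.

Lemma bmeasN X : bmeas X -> bmeas (fun w => - X w).
Proof.
move=> [xr xi [c xc]]; split.
- by under eq_fun do rewrite ReCN; exact: measurableT_comp.
- by under eq_fun do rewrite ImCN; exact: measurableT_comp.
- by exists c => w; rewrite ncN.
Qed.

Lemma bmeasB X Y : bmeas X -> bmeas Y -> bmeas (fun w => X w - Y w).
Proof. by move=> mX mY; apply: bmeasD => //; exact: bmeasN. Qed.

Lemma bmeasM X Y : bmeas X -> bmeas Y -> bmeas (fun w => X w * Y w).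
Proof.
move=> [xr xi [c xc]] [yr yi [c' yc]]; split.
- by under eq_fun do rewrite ReCM; apply: measurable_funB; exact: measurable_funM.
- by under eq_fun do rewrite ImCM; apply: measurable_funD; exact: measurable_funM.
- by exists (c * c') => w; rewrite ncM ler_pM// nc_ge0.
Qed.

Lemma bmeas_sum (I : Type) (r : seq I) (F : I -> T -> R[i]) :
  (forall i, bmeas (F i)) -> bmeas (fun w => \sum_(i <- r) F i w).
Proof.
move=> mF; elim: r => [|i r IH].
  by under eq_fun do rewrite big_nil; exact: bmeas_cst.
by under eq_fun do rewrite big_cons; exact: bmeasD.
Qed.

Lemma bmeas_prod (I : Type) (r : seq I) (Q : pred I) (F : I -> T -> R[i]) :
  (forall i, bmeas (F i)) -> bmeas (fun w => \prod_(i <- r | Q i) F i w).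
Proof.
move=> mF; elim: r => [|i r IH].
  by under eq_fun do rewrite big_nil; exact: bmeas_cst.
under eq_fun do rewrite big_cons; case: (Q i) => //; exact: bmeasM.
Qed.

Lemma bmeas_real (f : T -> R) c : measurable_fun setT f ->
  (forall w, `|f w| <= c) -> bmeas (fun w => (f w)%:C).
Proof.
by move=> mf fc; split => //=; exists c => w; have := fc w; rewrite -nc_real.
Qed.

Lemma bmeas_Re X : bmeas X -> bmeas (fun w => (complex.Re (X w))%:C).
Proof.
move=> [mr _ [c Xc]]; apply: (bmeas_real (c := c)) => // w.
by rewrite (le_trans (ler_Re_nc _)).
Qed.

Lemma bmeas_Im X : bmeas X -> bmeas (fun w => (complex.Im (X w))%:C).
Proof.
move=> [_ mi [c Xc]]; apply: (bmeas_real (c := c)) => // w.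
by rewrite (le_trans (ler_Im_nc _)).
Qed.

Lemma bmeas_indic (A : set T) : measurable A -> bmeas (fun w => (\1_A w)%:C).
Proof.
move=> mA; apply: (bmeas_real (c := 1)) => [|w].
  exact: measurable_indic.
by rewrite indicE ger0_norm// lern1 leq_b1.
Qed.

Lemma integrable_Re X : bmeas X -> P.-integrable setT (fun w => (complex.Re (X w))%:E).
Proof.
move=> [mr _ [c Xc]]; apply: measurable_bounded_integrable => //.
  by rewrite ltey_eq fin_num_measure.
exists c; split; first exact: num_real.
by move=> x cx w _ /=; rewrite (le_trans (ler_Re_nc _))// (le_trans (Xc w))// ltW.
Qed.

Lemma integrable_Im X : bmeas X -> P.-integrable setT (fun w => (complex.Im (X w))%:E).
Proof. by move=> mX; have := integrable_Re (bmeas_Im mX). Qed.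

Lemma Re_cE X : complex.Re (cexpectation P X) = \int[P]_w complex.Re (X w).
Proof. by rewrite /cexpectation expectation.unlock. Qed.

Lemma Im_cE X : complex.Im (cexpectation P X) = \int[P]_w complex.Im (X w).
Proof. by rewrite /cexpectation expectation.unlock. Qed.

Lemma cE_ae X Y : {ae P, forall w, X w = Y w} -> cexpectation P X = cexpectation P Y.
Proof.
move=> XY; apply: eq_ReIm; rewrite ?Re_cE ?Im_cE /Rintegral; congr fine;
by apply: integral_ae_eq; apply: filterS XY => w ->.
Qed.

Lemma eq_cE X Y : X =1 Y -> cexpectation P X = cexpectation P Y.
Proof. by move=> /funext ->. Qed.

Lemma cED X Y : bmeas X -> bmeas Y ->
  cexpectation P (fun w => X w + Y w) = cexpectation P X + cexpectation P Y.
Proof.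
move=> mX mY; apply: eq_ReIm.
  rewrite ReCD !Re_cE -RintegralD//; [|exact: integrable_Re..].
  by apply: eq_Rintegral => w _; rewrite ReCD.
rewrite ImCD !Im_cE -RintegralD//; [|exact: integrable_Im..].
by apply: eq_Rintegral => w _; rewrite ImCD.
Qed.

Lemma cEZ z X : bmeas X ->
  cexpectation P (fun w => z * X w) = z * cexpectation P X.
Proof.
move=> mX; have [iR iI] := (integrable_Re mX, integrable_Im mX).
have ZR c : P.-integrable setT (fun w => (c * complex.Re (X w))%:E).
  by under eq_fun do rewrite EFinM; exact: integrableZl.
have ZI c : P.-integrable setT (fun w => (c * complex.Im (X w))%:E).
  by under eq_fun do rewrite EFinM; exact: integrableZl.
apply: eq_ReIm.
  rewrite ReCM !Re_cE !Im_cE -!RintegralZl// -RintegralB//; last 2 first.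
  - exact: ZR.
  - exact: ZI.
  by apply: eq_Rintegral => w _; rewrite ReCM.
rewrite ImCM !Re_cE !Im_cE -!RintegralZl// -RintegralD//; last 2 first.
- exact: ZI.
- exact: ZR.
by apply: eq_Rintegral => w _; rewrite ImCM.
Qed.

Lemma cEN X : bmeas X -> cexpectation P (fun w => - X w) = - cexpectation P X.
Proof. by move=> mX; rewrite -mulN1r -cEZ//; apply: eq_cE => w; rewrite mulN1r. Qed.

Lemma cEB X Y : bmeas X -> bmeas Y ->
  cexpectation P (fun w => X w - Y w) = cexpectation P X - cexpectation P Y.
Proof. by move=> mX mY; rewrite cED ?cEN//; exact: bmeasN. Qed.

Lemma cE_cst z : cexpectation P (fun=> z) = z.
Proof.
by apply: eq_ReIm; rewrite ?Re_cE ?Im_cE Rintegral_cst//= probability_setT mulr1.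
Qed.

Lemma cE_sum (I : Type) (r : seq I) (F : I -> T -> R[i]) :
  (forall i, bmeas (F i)) ->
  cexpectation P (fun w => \sum_(i <- r) F i w) = \sum_(i <- r) cexpectation P (F i).
Proof.
move=> mF; elim: r => [|i r IH].
  by under eq_fun do rewrite big_nil; rewrite big_nil cE_cst.
under eq_fun do rewrite big_cons; rewrite big_cons cED// ?IH//.
exact: bmeas_sum.
Qed.

Lemma cE_indic (A : set T) : measurable A ->
  cexpectation P (fun w => (\1_A w)%:C) = (fine (P A))%:C.
Proof.
move=> mA; apply: eq_ReIm; rewrite ?Re_cE ?Im_cE /=.
  by rewrite /Rintegral integral_indic// setIT.
by rewrite Rintegral_cst// mul0r.
Qed.

Lemma ler_nc_cE X (f : T -> R) : bmeas X -> bmeas (fun w => (f w)%:C) ->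
  (forall w, nc (X w) <= f w) -> nc (cexpectation P X) <= \int[P]_w f w.
Proof.
move=> mX mf Xf; set z := cexpectation P X.
have [z0|z0] := eqVneq (nc z) 0.
  by rewrite z0 Rintegral_ge0// => w _; rewrite (le_trans (nc_ge0 _) (Xf w)).
have zp : 0 < nc z by rewrite lt_neqAle eq_sym z0 nc_ge0.
rewrite -(ler_pM2l zp) -RintegralZl//; last exact: (integrable_Re mf).
(* |E X|^2 = E Re (conj (E X) X) *)
have -> : nc z * nc z = \int[P]_w complex.Re ((z^* )%C * X w).
  rewrite -Re_cE cEZ// -/z -expr2 sqr_nc ReCM; case: (z) => a b /=; ring.
apply: le_Rintegral => //.
- by apply: integrable_Re; apply: bmeasM => //; exact: bmeas_cst.
- have := integrable_Re (bmeasM (bmeas_cst (nc z)%:C) mf).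
  by under eq_fun do rewrite ReCM /= mul0r subr0.
- move=> w _; rewrite (le_trans (ler_norm _))// (le_trans (ler_Re_nc _))// ncM.
  rewrite (_ : nc (z^* )%C = nc z) ?ler_pM ?nc_ge0//.
  by case: (z) => a b /=; rewrite sqrrN.
Qed.

Lemma ler_nc_cE_cst X c : bmeas X -> (forall w, nc (X w) <= c) ->
  nc (cexpectation P X) <= c.
Proof.
move=> mX Xc; have := @ler_nc_cE X (cst c) mX (bmeas_cst c%:C) Xc.
by rewrite Rintegral_cst//= probability_setT mulr1.
Qed.

Lemma Rintegral_cvg (f : nat -> T -> R) g c :
  (forall n, measurable_fun setT (f n)) -> (forall n w, `|f n w| <= c) ->
  (forall w, f n w @[n --> \oo] --> g w) ->
  \int[P]_w f n w @[n --> \oo] --> \int[P]_w g w.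
Proof.
move=> mf fc fg.
have iC : P.-integrable setT (cst c%:E) by exact: finite_measure_integrable_cst.
have mg : measurable_fun setT g by exact: (measurable_fun_cvg mf).
have gc w : `|g w| <= c.
  rewrite -(cvg_lim _ (cvg_norm (fg w)))//; apply: limr_le.
    by apply/cvg_ex; exists (`|g w|); exact: cvg_norm.
  by near=> n.
have ig : P.-integrable setT (fun w => (g w)%:E).
  apply: measurable_bounded_integrable => //.
    by rewrite ltey_eq fin_num_measure.
  exists c; split; first exact: num_real.
  by move=> x cx w _ /=; rewrite (le_trans (gc w))// ltW.
apply: fine_cvg; rewrite fineK; last exact: integrable_fin_num.
apply: (dominated_cvg measurableT (g := cst c%:E)) => //.
- by move=> n; exact/measurable_EFinP.
- by move=> w _; apply: cvg_EFin; [exact: nearW|exact: fg].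
- by move=> n w _ /=; rewrite lee_fin.
Unshelve. all: by end_near.
Qed.

Lemma cE_cvg (X : nat -> T -> R[i]) Y c :
  (forall n, bmeas (X n)) -> (forall n w, nc (X n w) <= c) ->
  (forall w, ccvg \oo (X ^~ w) (Y w)) ->
  ccvg \oo (fun n => cexpectation P (X n)) (cexpectation P Y).
Proof.
move=> mX Xc XY; split.
- rewrite Re_cE; under eq_fun do rewrite Re_cE.
  apply: (Rintegral_cvg (c := c)) => [n|n w|w].
  + by case: (mX n).
  + by rewrite (le_trans (ler_Re_nc _)).
  + by case: (XY w).
- rewrite Im_cE; under eq_fun do rewrite Im_cE.
  apply: (Rintegral_cvg (c := c)) => [n|n w|w].
  + by case: (mX n).
  + by rewrite (le_trans (ler_Im_nc _)).
  + by case: (XY w).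
Qed.

End cexpectation.

(** * Independence and expectations of products *)

Section independence.
Context (R : realType) (d : measure_display) (T : measurableType d).
Variable P : probability T R.
Implicit Types X Y : T -> R[i].

(** Cells of mesh 1/(n+1), shifted by [c] so that a variable bounded by [c] in modulus meets only
    cells with a natural index. *)
Definition level_indic (V : T -> R) (c : R) (n k : nat) : T -> R :=
  \1_(V @^-1` `[k%:R / n.+1%:R - c, k.+1%:R / n.+1%:R - c[).

(** [V] rounded down to the grid. Since [V + c] lies between 0 and 2c, the last index that can occur
    is the truncation of 2c(n+1), hence the successor in the range of the sum. *)
Definition simple_approx (V : T -> R) (c : R) (n : nat) (w : T) : R :=
  \sum_(k < (Num.trunc ((c + c) * n.+1%:R)).+1)
    (k%:R / n.+1%:R - c) * level_indic V c n k w.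

Lemma simple_approxE V (c : R) n w : `|V w| <= c ->
  simple_approx V c n w = (Num.trunc ((V w + c) * n.+1%:R))%:R / n.+1%:R - c.
Proof.
move=> Vc; have n0 : 0 < n.+1%:R :> R by rewrite ltr0n.
have /andP[Vc1 Vc2] : - c <= V w <= c by rewrite -ler_norml.
have Vge0 : 0 <= (V w + c) * n.+1%:R.
  by rewrite mulr_ge0// -lerBlDr sub0r.
set m := Num.trunc _; have mE : forall k : nat,
    (w \in V @^-1` `[k%:R / n.+1%:R - c, k.+1%:R / n.+1%:R - c[) = (m == k).
  move=> k; rewrite truncn_eq// -!(ler_pdivrMr _ _ n0) -!(ltr_pdivlMr _ _ n0).
  by rewrite -lerBlDr -ltrBrDr; apply/idP/idP; rewrite inE/= in_itv.
have mlt : (m < (Num.trunc ((c + c) * n.+1%:R)).+1)%N.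
  by rewrite ltnS le_truncn// ler_wpM2r// ?lerD2r// ltW.
rewrite /simple_approx (bigD1 (Ordinal mlt))//= /level_indic indicE mE eqxx mulr1.
rewrite big1 ?addr0// => k /negbTE km; rewrite indicE mE.
by rewrite (_ : m == k = false) ?mulr0//; apply/negbTE; move: km; rewrite -val_eqE/= eq_sym => ->.
Qed.

Lemma simple_approx_dist V (c : R) n w : `|V w| <= c ->
  `|simple_approx V c n w - V w| <= n.+1%:R^-1.
Proof.
move=> Vc; rewrite simple_approxE//.
have n0 : 0 < n.+1%:R :> R by rewrite ltr0n.
have /andP[Vc1 Vc2] : - c <= V w <= c by rewrite -ler_norml.
have Vge0 : 0 <= (V w + c) * n.+1%:R.
  by rewrite mulr_ge0// -lerBlDr sub0r.
have /andP[m1 m2] := truncn_itv Vge0; set m := Num.trunc _ in m1 m2 *.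
rewrite -ler_pdivrMr// in m1; rewrite -ltr_pdivlMr// -natr1 mulrDl mul1r in m2.
move: m1 m2; set x := m%:R / n.+1%:R; set y := n.+1%:R^-1; move: x y => x y m1 m2.
by rewrite ler_norml; apply/andP; split; lra.
Qed.

Lemma simple_approx_cvg V (c : R) w : `|V w| <= c ->
  simple_approx V c n w @[n --> \oo] --> V w.
Proof.
move=> Vc; apply/cvgrPdist_le => e e0; near=> n.
rewrite distrC (le_trans (simple_approx_dist _ Vc))//; near: n.
by have /cvgrPdist_le/(_ _ e0) := @cvg_harmonic R; apply: filterS => n;
  rewrite sub0r normrN ger0_norm// harmonic_ge0.
Unshelve. all: by end_near. Qed.

(** Only [V] is approximated by simple functions, while [W] stays whole. This lets [W] be a mixed
    product of indicators and variables when the factors of a product are treated in turn. *)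
Lemma cE_mul_real W (V : T -> R) (c : R) : bmeas W -> measurable_fun setT V ->
  (forall w, `|V w| <= c) ->
  (forall A, measurable A -> cexpectation P (fun w => W w * (\1_(V @^-1` A) w)%:C) =
     cexpectation P W * (fine (P (V @^-1` A)))%:C) ->
  cexpectation P (fun w => W w * (V w)%:C) =
    cexpectation P W * cexpectation P (fun w => (V w)%:C).
Proof.
move=> mW mV Vc WV.
have mVA A : measurable A -> measurable (V @^-1` A).
  by move=> mA; rewrite -[X in measurable X]setTI; exact: mV.
have mL n k : bmeas (fun w => (level_indic V c n k w)%:C).
  by apply: bmeas_indic; apply: mVA.
have sE n w : (simple_approx V c n w)%:C =
    \sum_(k < (Num.trunc ((c + c) * n.+1%:R)).+1)
      (k%:R / n.+1%:R - c)%:C * (level_indic V c n k w)%:C.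
  by rewrite rmorph_sum; apply: eq_bigr => k _; rewrite rmorphM.
have mS n : bmeas (fun w => (simple_approx V c n w)%:C).
  under eq_fun do rewrite sE.
  by apply: bmeas_sum => k; apply: bmeasM => //; exact: bmeas_cst.
have Sc n w : nc (simple_approx V c n w)%:C <= c + 1.
  rewrite nc_real -[simple_approx _ _ _ _](subrK (V w)) (le_trans (ler_normD _ _))//.
  rewrite addrC lerD// (le_trans (simple_approx_dist _ (Vc w)))// invf_le1 ?ler1n ?ltr0n//.
have [_ _ [b Wb]] := mW.
have cvgS w : ccvg \oo (fun n => (simple_approx V c n w)%:C) (V w)%:C.
  by apply: ccvg_real; exact: simple_approx_cvg.
have c1 := cE_cvg P mS Sc cvgS.
have c2 : ccvg \oo (fun n => cexpectation P (fun w => W w * (simple_approx V c n w)%:C))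
    (cexpectation P (fun w => W w * (V w)%:C)).
  apply: (cE_cvg P (c := b * (c + 1))) => [n|n w|w].
  - exact: bmeasM.
  - by rewrite ncM ler_pM ?nc_ge0.
  - by apply: ccvgM => //; exact: ccvg_cst.
apply: ccvg_unique c2 _.
apply: ccvg_near_eq (ccvgM (ccvg_cst _) c1); apply: nearW => n.
have -> : cexpectation P (fun w => W w * (simple_approx V c n w)%:C) =
    \sum_(k < (Num.trunc ((c + c) * n.+1%:R)).+1)
      (k%:R / n.+1%:R - c)%:C * cexpectation P (fun w => W w * (level_indic V c n k w)%:C).
  transitivity (cexpectation P (fun w => \sum_(k < (Num.trunc ((c + c) * n.+1%:R)).+1)
      (k%:R / n.+1%:R - c)%:C * (W w * (level_indic V c n k w)%:C))).
    by apply: eq_cE => w; rewrite sE mulr_sumr; apply: eq_bigr => k _; rewrite mulrCA.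
  rewrite cE_sum; last by move=> k; apply: bmeasM; [exact: bmeas_cst|exact: bmeasM].
  by apply: eq_bigr => k _; rewrite cEZ//; exact: bmeasM.
rewrite (eq_cE P (sE n)) cE_sum; last by move=> k; apply: bmeasM => //; exact: bmeas_cst.
rewrite mulr_sumr; apply: eq_bigr => k _.
rewrite (cEZ P _ (mL n k)) mulrCA; congr (_ * _).
rewrite /level_indic cE_indic; last by apply: mVA.
by rewrite WV.
Qed.

(** [F] is any family of events, so that the sigma-algebra of one variable and the generated
    sigma-algebra of a process are handled alike. *)
Definition fmeas (F : set (set T)) X := forall A : set R, measurable A ->
  F ((fun w => complex.Re (X w)) @^-1` A) /\ F ((fun w => complex.Im (X w)) @^-1` A).

Lemma cE_mul_indep W X (F : set (set T)) : bmeas W -> bmeas X -> fmeas F X ->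
  (forall S, F S -> cexpectation P (fun w => W w * (\1_S w)%:C) =
     cexpectation P W * (fine (P S))%:C) ->
  cexpectation P (fun w => W w * X w) = cexpectation P W * cexpectation P X.
Proof.
move=> mW mX FX WF; have [mR mI [c Xc]] := mX.
have hR : cexpectation P (fun w => W w * (complex.Re (X w))%:C) =
    cexpectation P W * cexpectation P (fun w => (complex.Re (X w))%:C).
  apply: (cE_mul_real (c := c)) => // [w|A mA].
    exact: le_trans (ler_Re_nc _) (Xc w).
  by apply: WF; have [] := FX A mA.
have hI : cexpectation P (fun w => W w * (complex.Im (X w))%:C) =
    cexpectation P W * cexpectation P (fun w => (complex.Im (X w))%:C).
  apply: (cE_mul_real (c := c)) => // [w|A mA].
    exact: le_trans (ler_Im_nc _) (Xc w).
  by apply: WF; have [] := FX A mA.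
have mXR := bmeas_Re mX; have mXI := bmeas_Im mX.
have -> : cexpectation P X = cexpectation P (fun w => (complex.Re (X w))%:C) +
    'i%C * cexpectation P (fun w => (complex.Im (X w))%:C).
  rewrite -cEZ// -cED//; last by apply: bmeasM => //; exact: bmeas_cst.
  by apply: eq_cE => w; rewrite -complexE.
have -> : cexpectation P (fun w => W w * X w) =
    cexpectation P (fun w => W w * (complex.Re (X w))%:C) +
    'i%C * cexpectation P (fun w => W w * (complex.Im (X w))%:C).
  rewrite -cEZ; last exact: bmeasM.
  rewrite -cED; last 2 first.
  - exact: bmeasM.
  - by apply: bmeasM; [exact: bmeas_cst|exact: bmeasM].
  by apply: eq_cE => w; rewrite mulrCA -mulrDr -complexE.
by rewrite hR hI mulrDr mulrCA.
Qed.

Lemma fine_prod_prob (I : Type) (r : seq I) (Q : pred I) (A : I -> set T) :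
  (forall i, measurable (A i)) ->
  fine (\prod_(i <- r | Q i) P (A i))%E = \prod_(i <- r | Q i) fine (P (A i)).
Proof.
move=> mA; have -> : (\prod_(i <- r | Q i) P (A i) =
    (\prod_(i <- r | Q i) fine (P (A i)))%:E)%E; last by [].
rewrite (big_morph EFin EFinM erefl).
by apply: eq_bigr => i _; rewrite fineK// fin_num_measure.
Qed.

Lemma prod_indic (I : finType) (A : I -> set T) w :
  \prod_i (\1_(A i) w : R) = \1_(\bigcap_i A i) w.
Proof.
rewrite indicE; have [/set_mem wA|/negP wA] := boolP (w \in \bigcap_i A i).
  by rewrite big1// => i _; rewrite indicE mem_set//; exact: wA.
have [i iA] : exists i, ~ A i w.
  by apply/existsNP => wAi; apply: wA; rewrite inE => i _; exact: wAi.
by rewrite (bigD1 i)//= indicE memNset// mul0r.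
Qed.

Lemma mutually_independentT (I : finType) (F : I -> set (set T)) (A : I -> set T) :
  mutually_independent P F -> (forall i, F i (A i)) ->
  P (\bigcap_i A i) = (\prod_i P (A i))%E.
Proof.
move=> FP FA; have := FP [set: I]%SET A (fun i _ => FA i).
rewrite (_ : [set` [set: I]%SET] = setT); last by apply/seteqP; split => i //=; rewrite inE.
by move=> ->; apply: eq_bigl => i; rewrite inE.
Qed.

Lemma cE_prod_indep (I : finType) (F : I -> set (set T)) (X : I -> T -> R[i]) :
  (forall i A, F i A -> measurable A) ->
  (forall A : I -> set T, (forall i, F i (A i)) ->
    P (\bigcap_i A i) = (\prod_i P (A i))%E) ->
  (forall i, bmeas (X i)) -> (forall i, fmeas (F i) (X i)) ->
  cexpectation P (fun w => \prod_i X i w) = \prod_i cexpectation P (X i).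
Proof.
move=> mF FP mX FX.
(* With the sure event in every [F i], the product formula over all indices contains the formulas
   for subfamilies. *)
have FT i : F i setT by have [] := FX i _ measurableT.
(* The factors [X i] replace indicators of events of [F i] one at a time. *)
suff key (s : seq I) : uniq s -> forall A : I -> set T, (forall i, F i (A i)) ->
    cexpectation P (fun w => (\prod_(i <- s) X i w) *
      \prod_(i | i \notin s) (\1_(A i) w)%:C) =
    (\prod_(i <- s) cexpectation P (X i)) *
      \prod_(i | i \notin s) (fine (P (A i)))%:C.
  have := key _ (index_enum_uniq I) (fun=> setT) FT.
  rewrite [X in _ * X]big_pred0 => [|i]; last by rewrite mem_index_enum.
  rewrite mulr1 => <-; apply: eq_cE => w.
  by rewrite [X in _ * X]big_pred0 ?mulr1// => i; rewrite mem_index_enum.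
have mFA A : (forall i, F i (A i)) -> forall i, measurable (A i).
  by move=> FA i; exact: mF (FA i).
elim: s => [_ A FA|m s IH /= /andP[ms us] A FA].
  under (eq_cE P) do rewrite big_nil mul1r -rmorph_prod prod_indic.
  rewrite big_nil mul1r -rmorph_prod cE_indic; last first.
    by apply: fin_bigcap_measurable => [|i _]; [exact: finite_finset|exact: mFA].
  by rewrite FP// fine_prod_prob//; exact: mFA.
pose W w := (\prod_(i <- s) X i w) * \prod_(i | i \notin m :: s) (\1_(A i) w)%:C.
have mW : bmeas W.
  apply: bmeasM; first exact: bmeas_prod.
  by apply: bmeas_prod => i; apply: bmeas_indic; exact: mFA.
(* The induction hypothesis is used with the event at [m] left free: letting [S] vary over [F m]
   gives the factorization against indicators from which [X m] is built. *)
pose A' S i := if i == m then S else A i.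
have FA' S : F m S -> forall i, F i (A' S i).
  by move=> FS i; rewrite /A'; case: eqVneq => [->|].
have splitm (G : I -> R[i]) : \prod_(i | i \notin s) G i =
    G m * \prod_(i | i \notin m :: s) G i.
  rewrite (bigD1 m)//=; congr (_ * _); apply: eq_bigl => i.
  by rewrite inE negb_or andbC.
have WS S : F m S -> cexpectation P (fun w => W w * (\1_S w)%:C) =
    (\prod_(i <- s) cexpectation P (X i)) *
    ((fine (P S))%:C * \prod_(i | i \notin m :: s) (fine (P (A i)))%:C).
  move=> FS; have A'm : A' S m = S by rewrite /A' eqxx.
  have A'i i : i \notin m :: s -> A' S i = A i.
    by rewrite inE negb_or /A' => /andP[/negbTE ->].
  have := IH us _ (FA' S FS); rewrite [X in _ = _ * X -> _]splitm A'm.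
  rewrite [X in _ = _ * (_ * X) -> _](eq_bigr (fun i => (fine (P (A i)))%:C)); last first.
    by move=> i /A'i ->.
  move=> <-; apply: eq_cE => w; rewrite /W splitm A'm -mulrA [X in _ * X]mulrC.
  by congr (_ * (_ * _)); apply: eq_bigr => i /A'i ->.
have WE : cexpectation P W = (\prod_(i <- s) cexpectation P (X i)) *
    \prod_(i | i \notin m :: s) (fine (P (A i)))%:C.
  have := WS _ (FT m); rewrite probability_setT mul1r => <-.
  by apply: eq_cE => w; rewrite indicT mulr1.
rewrite [X in _ = X * _]big_cons -[RHS]mulrA -WE [RHS]mulrC.
rewrite -(cE_mul_indep mW (mX m) (FX m)); last first.
  by move=> S FS; rewrite WS// WE mulrCA mulrC.
by apply: eq_cE => w; rewrite /W big_cons -mulrA mulrC.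
Qed.

End independence.

(** * Countable-valued variables and conditioning on them *)

Section discrete.
Context (R : realType) (d : measure_display) (T : measurableType d).
Variable P : probability T R.
Implicit Types X Y : T -> R[i].

Lemma measurable_discrete (K : countType) (D : T -> K) (S : set K) :
  (forall k, measurable (D @^-1` [set k])) -> measurable (D @^-1` S).
Proof.
move=> mD; have -> : D @^-1` S = \bigcup_k (D @^-1` ([set k] `&` S)).
  by apply/seteqP; split => [w Sw|w [k _ [/= -> //]]]; exists (D w).
apply: countable_bigcupT_measurable => [|k]; first exact: countableP.
have [Sk|Sk] := pselect (S k).
  by rewrite (_ : _ `&` _ = [set k])//; apply/seteqP; split => [x []|x ->].
rewrite (_ : _ `&` _ = set0) ?preimage_set0//.
by apply/seteqP; split => [x [->]|].
Qed.

Lemma measurable_fun_discrete (K : countType) (D : T -> K) (f : K -> R) :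
  (forall k, measurable (D @^-1` [set k])) -> measurable_fun setT (f \o D).
Proof.
move=> mD _ A mA; rewrite setTI comp_preimage; exact: measurable_discrete.
Qed.

Lemma bmeas_discrete (K : countType) (D : T -> K) (f : K -> R[i]) c :
  (forall k, measurable (D @^-1` [set k])) -> (forall k, nc (f k) <= c) ->
  bmeas (fun w => f (D w)).
Proof.
move=> mD fc; split.
- exact: (measurable_fun_discrete (fun k => complex.Re (f k)) mD).
- exact: (measurable_fun_discrete (fun k => complex.Im (f k)) mD).
- by exists c.
Qed.

(** Evaluates a family at a countable-valued random index: measurability on each cell takes the
    place of joint measurability in time and outcome. *)
Lemma bmeas_mixture (K : countType) (D : T -> K) (X : K -> T -> R[i]) (c : R) :
  (forall k, measurable (D @^-1` [set k])) -> (forall k, bmeas (X k)) ->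
  (forall k w, nc (X k w) <= c) -> bmeas (fun w => X (D w) w).
Proof.
move=> mD mX Xc.
have mmix (f : K -> T -> R) : (forall k, measurable_fun setT (f k)) ->
    measurable_fun setT (fun w => f (D w) w).
  move=> mf _ A mA; rewrite setTI.
  have -> : (fun w => f (D w) w) @^-1` A =
      \bigcup_k ((D @^-1` [set k]) `&` (f k @^-1` A)).
    apply/seteqP; split => [w Aw|w [k _ [/= <-]]//].
    by exists (D w).
  apply: countable_bigcupT_measurable => [|k]; first exact: countableP.
  by apply: measurableI => //; rewrite -[X in measurable X]setTI; exact: mf.
split.
- by apply: (mmix (fun k w => complex.Re (X k w))) => k; case: (mX k).
- by apply: (mmix (fun k w => complex.Im (X k w))) => k; case: (mX k).
- by exists c.
Qed.

(** The substitute for conditioning on [D]: two expectations agree once they agree on every cell,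
    because the sums over finitely many cells converge boundedly. *)
Lemma cE_partition (K : countType) (D : T -> K) X Y :
  (forall k, measurable (D @^-1` [set k])) -> bmeas X -> bmeas Y ->
  (forall k, cexpectation P (fun w => (\1_(D @^-1` [set k]) w)%:C * X w) =
             cexpectation P (fun w => (\1_(D @^-1` [set k]) w)%:C * Y w)) ->
  cexpectation P X = cexpectation P Y.
Proof.
move=> mD mX mY XY; pose Z w := X w - Y w.
have mZ : bmeas Z by exact: bmeasB.
suff : cexpectation P Z = 0 by rewrite cEB// => /eqP; rewrite subr_eq0 => /eqP.
have mI k : bmeas (fun w => (\1_(D @^-1` [set k]) w)%:C * Z w).
  by apply: bmeasM => //; exact: bmeas_indic.
have IZ k : cexpectation P (fun w => (\1_(D @^-1` [set k]) w)%:C * Z w) = 0.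
  have mIX := bmeasM (bmeas_indic R (mD k)) mX.
  have mIY := bmeasM (bmeas_indic R (mD k)) mY.
  rewrite -[RHS](subrr (cexpectation P (fun w => (\1_(D @^-1` [set k]) w)%:C * X w))).
  by rewrite {2}XY -cEB//; apply: eq_cE => w; rewrite mulrBr.
(* The cells are enumerated through the codes of [K]; a number that codes no element contributes
   0. *)
pose G (i : nat) w := if @pickle_inv K i is Some k then
  (\1_(D @^-1` [set k]) w)%:C * Z w else 0.
have mG i : bmeas (G i) by rewrite /G; case: pickle_inv => // ; exact: bmeas_cst.
have GE i w : G i w = (pickle (D w) == i)%:R * Z w.
  rewrite /G; case E : (@pickle_inv K i) => [k|].
    rewrite indicE; congr (_ * _); rewrite -[LHS]/((_)%:R%:C).
    have [Dk|Dk] := eqVneq (D w) k.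
      have := @pickle_invK K i; rewrite E /= Dk => ->; rewrite eqxx.
      by rewrite mem_set.
    rewrite memNset; last by move=> /= /eqP; rewrite (negbTE Dk).
    case: eqVneq => // Di; move: E; rewrite -Di pickleK_inv => -[] /eqP.
    by rewrite (negbTE Dk).
  case: eqVneq => [Di|]; last by rewrite mul0r.
  by move: E; rewrite -Di pickleK_inv.
have SE n w : \sum_(i < n) G i w = (pickle (D w) < n)%N%:R * Z w.
  under eq_bigr do rewrite GE; rewrite -mulr_suml; congr (_ * _).
  case: ltnP => [Dn|nD].
    rewrite (bigD1 (Ordinal Dn))//= eqxx big1 ?addr0// => i.
    by rewrite -val_eqE/= eq_sym => /negbTE ->.
  rewrite big1// => i _; case: eqVneq => // Di.
  by have := ltn_ord i; rewrite -Di ltnNge nD.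
have [_ _ [c Zc]] := mZ.
have cv := @cE_cvg _ _ _ P (fun n w => \sum_(i < n) G i w) Z c.
apply: ccvg_unique (cv _ _ _) _ => [n|n w|w|].
- exact: bmeas_sum.
- rewrite SE ncM; case: ltnP => _; first by rewrite nc1 mul1r.
  by rewrite nc0 mul0r (le_trans (nc_ge0 _) (Zc w)).
- apply: ccvg_near; near=> n; rewrite SE.
  have -> : (pickle (D w) < n)%N by near: n; exact: nbhs_infty_gt.
  by rewrite mul1r.
- apply: ccvg_near; apply: nearW => n; rewrite cE_sum// big1// => i _.
  by rewrite /G; case: pickle_inv => [k|]; rewrite ?IZ ?cE_cst.
Unshelve. all: by end_near.
Qed.

(** The product form matters in the approximation of an exponential law, where [p] and [z] tend to 1
    and both sides vanish: they are divided by the mesh before the limit is taken. *)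
Lemma cE_geometric (K : T -> nat) (p : R) (z : R[i]) : 0 <= p < 1 -> nc z <= 1 ->
  (forall k, measurable (K @^-1` [set k])) ->
  (forall k, P (K @^-1` [set k]) = ((1 - p) * p ^+ k)%:E) ->
  cexpectation P (fun w => z ^+ K w) * (1 - p%:C * z) = 1 - p%:C.
Proof.
move=> /andP[p0 p1] z1 mK PK.
have mI k : bmeas (fun w => z ^+ k * (\1_(K @^-1` [set k]) w : R)%:C).
  by apply: bmeasM; [exact: bmeas_cst|exact: bmeas_indic].
pose G n w := \sum_(k < n) z ^+ k * (\1_(K @^-1` [set val k]) w)%:C.
have GE n w : G n w = (K w < n)%N%:R * z ^+ K w.
  rewrite /G; case: ltnP => [Kn|nK].
    rewrite (bigD1 (Ordinal Kn))//= indicE mem_set// mulr1 mul1r big1 ?addr0// => i.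
    rewrite -val_eqE/= => /eqP iK; rewrite indicE memNset ?mulr0//= => Ki.
    exact: iK.
  rewrite mul0r big1// => i _; rewrite indicE memNset ?mulr0//= => Ki.
  by have := ltn_ord i; rewrite -Ki ltnNge nK.
have cv : ccvg \oo (fun n => cexpectation P (G n)) (cexpectation P (fun w => z ^+ K w)).
  apply: (cE_cvg P (c := 1)) => [n|n w|w].
  - exact: bmeas_sum.
  - rewrite GE ncM; case: ltnP => _; last by rewrite nc0 mul0r.
    by rewrite nc1 mul1r nc_exp_le1.
  - apply: ccvg_near; near=> n; rewrite GE.
    have -> : (K w < n)%N by near: n; exact: nbhs_infty_gt.
    by rewrite mul1r.
apply: ccvg_unique (ccvgM cv (ccvg_cst _)) _.
have pz : nc (p%:C * z) < 1.
  by rewrite ncM nc_real ger0_norm// (le_lt_trans _ p1)// ler_piMr.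
have -> : 1 - p%:C = (1 - p%:C) * (1 - 0) :> R[i] by rewrite subr0 mulr1.
apply: (@ccvg_near_eq _ _ _ _ (fun n => (1 - p%:C) * (1 - (p%:C * z) ^+ n))).
  apply: nearW => n; rewrite cE_sum//.
  transitivity ((\sum_(k < n) (1 - p%:C) * (p%:C * z) ^+ k) * (1 - p%:C * z)).
    by rewrite -mulr_sumr -mulrA -[1 - _ ^+ n]opprB subrX1 -mulNr opprB [(1 - p%:C * z) * _]mulrC.
  congr (_ * _); apply: eq_bigr => k _.
  rewrite cEZ ?cE_indic//; last exact: bmeas_indic.
  by rewrite PK /= exprMn [z ^+ k * _]mulrC -rmorphXn mulrA -[1]/(1%:C) -rmorphB -rmorphM.
apply: ccvgM; first exact: ccvg_cst.
apply: ccvgB; first exact: ccvg_cst.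
apply/ccvg_nc; under eq_fun do rewrite subr0 ncX.
by apply: cvg_expr; rewrite ger0_norm// nc_ge0.
Unshelve. all: by end_near.
Qed.

(** Every set of naturals is countable as a set of reals, hence Borel. *)
Lemma sigma_rv_nat (N : T -> nat) (S : set nat) :
  sigma_rv (fun w => (N w)%:R : R) (N @^-1` S).
Proof.
exists [set n%:R | n in S].
  apply: countable_measurable; first by move=> x; exact: measurable_set1.
  exact: sub_countable (card_image_le _ _) _.
rewrite setTI; apply/seteqP; split => [w /= [n Sn /eqP]|w Sw /=]; last by exists (N w).
by rewrite eqr_nat => /eqP <-.
Qed.

Lemma fmeas_sub (F G : set (set T)) X : F `<=` G -> fmeas F X -> fmeas G X.
Proof. by move=> FG FX A mA; have [] := FX A mA; split; exact: FG. Qed.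

Lemma fmeas_nat (N : T -> nat) (f : nat -> R[i]) :
  fmeas (sigma_rv (fun w => (N w)%:R : R)) (fun w => f (N w)).
Proof.
move=> A mA; split.
  exact: (sigma_rv_nat N [set n | A (complex.Re (f n))]).
exact: (sigma_rv_nat N [set n | A (complex.Im (f n))]).
Qed.

End discrete.

(** * Semigroups and Lévy processes *)

Section semigroup.
Context (R : realType).
Implicit Types f g : R -> R[i].

(** Continuity is recorded at 0 from the right only; the functional equation spreads it to later
    times in [csemigroup_dyadic]. *)
Definition csemigroup f :=
  (forall s t, 0 <= s -> 0 <= t -> f (s + t) = f s * f t) /\ ccvg (0 : R)^'+ f 1.

(** Let h decrease to 0 in f(h) = f(h) f(0). *)
Lemma csemigroup0 f : csemigroup f -> f 0 = 1.
Proof.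
move=> [fD f1]; apply: esym; apply: (ccvg_unique f1).
have H : ccvg (0 : R)^'+ (fun x => f x * f 0) (1 * f 0).
  by apply: ccvgM => //; exact: ccvg_cst.
rewrite mul1r in H; apply: (ccvg_near_eq _ H).
by near=> h; rewrite -fD ?addr0//; apply: ltW; near: h; exact: nbhs_right_gt.
Unshelve. all: by end_near. Qed.

Lemma csemigroupX f t n : csemigroup f -> 0 <= t -> f (n%:R * t) = f t ^+ n.
Proof.
move=> sf t0; elim: n => [|n IH]; first by rewrite mul0r expr0 csemigroup0.
by rewrite -natr1 mulrDl mul1r sf.1 ?mulr_ge0// IH exprSr.
Qed.

Lemma csemigroupM f g : csemigroup f -> csemigroup g ->
  csemigroup (fun s => f s * g s).
Proof.
move=> [fD f1] [gD g1]; split=> [s t s0 t0|]; first by rewrite fD// gD// mulrACA.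
by rewrite -[1]mulr1; exact: ccvgM.
Qed.

Lemma csemigroup_prod (I : Type) (r : seq I) (F : I -> R -> R[i]) :
  (forall i, csemigroup (F i)) -> csemigroup (fun s => \prod_(i <- r) F i s).
Proof.
move=> sF; elim: r => [|i r IH].
  under eq_fun do rewrite big_nil.
  by split => [s t _ _|]; [rewrite mulr1|exact: ccvg_cst].
by under eq_fun do rewrite big_cons; exact: csemigroupM.
Qed.

Lemma csemigroup_cexp (c : R[i]) : csemigroup (fun s : R => cexp (s%:C * c)).
Proof.
split=> [s t _ _|]; first by rewrite rmorphD mulrDl cexpD.
rewrite -cexp0 -(mul0r c); apply: ccvg_cexp; apply: ccvgM; last exact: ccvg_cst.
by apply: ccvg_real; apply: cvg_at_right_filter; exact: cvg_id.
Qed.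

Lemma csemigroup_scale f (a : R) : 0 < a -> csemigroup f ->
  csemigroup (fun s => f (a * s)).
Proof.
move=> a0 [fD f1]; split=> [s t s0 t0|].
  by rewrite mulrDr fD// mulr_ge0// ltW.
move/ccvg_nc/cvgrPdist_lt : f1 => f1; apply/ccvg_nc/cvgrPdist_lt => e /f1.
move=> [r r0 fr]; exists (r / a); first by rewrite /= divr_gt0.
move=> x /=; rewrite sub0r normrN ltr_pdivlMr// => xr x0.
apply: fr => /=; rewrite ?mulr_gt0//.
by rewrite sub0r normrN normrM (gtr0_norm a0) mulrC.
Qed.

(** Write [s] as a multiple of 2^-n plus a remainder below 2^-n: [f] is 1 at the multiple and close
    to 1 at the remainder. *)
Lemma csemigroup_dyadic f : csemigroup f -> (forall n, f (2 ^- n) = 1) ->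
  forall s, 0 <= s -> f s = 1.
Proof.
move=> sf f2 s s0; apply/eqP; rewrite -subr_eq0 -nc_eq0 eq_le nc_ge0 andbT.
apply/ler_addgt0Pr => e e0; rewrite add0r.
have [_ /ccvg_nc/cvgrPdist_le/(_ _ e0)[r /= r0 fr]] := sf.
have [n nr] : exists n, 2 ^- n < r.
  have h2 : `|2^-1 : R| < 1 by rewrite ger0_norm; lra.
  have /cvgrPdist_lt/(_ _ r0)[n _ /(_ n (leqnn n))] := cvg_geometric (1 : R) h2.
  by rewrite sub0r normrN /= mul1r exprVn ger0_norm// => ?; exists n.
set m := Num.trunc (s * 2 ^+ n).
have n20 : 0 < 2 ^+ n :> R by rewrite exprn_gt0.
have /truncn_itv/andP[m1 m2] : 0 <= s * 2 ^+ n by rewrite mulr_ge0// ltW.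
rewrite -/m -ler_pdivrMr// in m1; rewrite -/m -ltr_pdivlMr// -natr1 mulrDl mul1r in m2.
have -> : s = m%:R * 2 ^- n + (s - m%:R / 2 ^+ n) by rewrite addrC subrK.
rewrite sf.1 ?subr_ge0// ?mulr_ge0 ?invr_ge0 ?(ltW n20)// csemigroupX// ?invr_ge0 ?(ltW n20)//.
(* A zero remainder is separate, since the limit from the right says nothing about the point 0
   itself. *)
rewrite f2 expr1n mul1r; have [->|h0] := eqVneq (s - m%:R / 2 ^+ n) 0.
  by rewrite csemigroup0// subrr nc0 ltW.
have hp : 0 < s - m%:R / 2 ^+ n by rewrite lt_neqAle eq_sym h0 subr_ge0.
have := fr (s - m%:R / 2 ^+ n); rewrite /= !sub0r !normrN (gtr0_norm hp) ger0_norm ?nc_ge0//.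
by apply => //; rewrite (lt_trans _ nr)// ltrBlDl.
Qed.

End semigroup.

(** * Characters of Lévy processes *)

Section levy_character.
Context (R : realType) (d : measure_display) (T : measurableType d).
Variable P : probability T R.

Lemma sigma_rv_measurable (V : T -> R) A : measurable_fun setT V -> sigma_rv V A -> measurable A.
Proof. by move=> mV [B mB <-]; exact: mV. Qed.

Lemma fmeas_comp (V : T -> R) (chi : R -> R[i]) : bmeas chi ->
  fmeas (sigma_rv V) (fun w => chi (V w)).
Proof.
move=> [mr mi _] A mA; split.
  exists ((fun x => complex.Re (chi x)) @^-1` A); last by rewrite setTI.
  by rewrite -[X in measurable X]setTI; exact: mr.
exists ((fun x => complex.Im (chi x)) @^-1` A); last by rewrite setTI.
by rewrite -[X in measurable X]setTI; exact: mi.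
Qed.

Lemma bmeas_comp (V : T -> R) (chi : R -> R[i]) : measurable_fun setT V ->
  bmeas chi -> bmeas (fun w => chi (V w)).
Proof.
move=> mV [mr mi [c chic]]; split.
- exact: (measurableT_comp mr mV).
- exact: (measurableT_comp mi mV).
- by exists c.
Qed.

Lemma Rintegral_eq_law (V V' : T -> R) (f : R -> R) (c : R) :
  measurable_fun setT V -> measurable_fun setT V' -> measurable_fun setT f ->
  (forall x, `|f x| <= c) ->
  (forall A, measurable A -> P (V @^-1` A) = P (V' @^-1` A)) ->
  \int[P]_w f (V w) = \int[P]_w f (V' w).
Proof.
move=> mV mV' mf fc VV'.
have iV (U : T -> R) : measurable_fun setT U ->
    P.-integrable setT ((fun x => (f x)%:E) \o U).
  move=> mU; have mfU : measurable_fun setT (f \o U) by exact: measurableT_comp.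
  exact: (@integrable_Re _ _ _ P _ (bmeas_real mfU (fun w => fc (U w)))).
have mEf : measurable_fun setT (fun x => (f x)%:E) by exact/measurable_EFinP.
rewrite /Rintegral; congr fine.
transitivity (\int[pushforward P V]_x (f x)%:E)%E.
  by rewrite (integral_pushforward mV mEf)//; exact: iV.
transitivity (\int[pushforward P V']_x (f x)%:E)%E.
  by apply: eq_measure_integral => A mA _; exact: VV'.
by rewrite (integral_pushforward mV' mEf)//; exact: iV.
Qed.

Lemma cE_eq_law (V V' : T -> R) (chi : R -> R[i]) :
  measurable_fun setT V -> measurable_fun setT V' -> bmeas chi ->
  (forall A, measurable A -> P (V @^-1` A) = P (V' @^-1` A)) ->
  cexpectation P (fun w => chi (V w)) = cexpectation P (fun w => chi (V' w)).
Proof.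
move=> mV mV' [mr mi [c chic]] VV'; apply: eq_ReIm.
  rewrite !Re_cE; apply: (Rintegral_eq_law (c := c)) mr _ _ => // x.
  exact: le_trans (ler_Re_nc _) _.
rewrite !Im_cE; apply: (Rintegral_eq_law (c := c)) mi _ _ => // x.
exact: le_trans (ler_Im_nc _) _.
Qed.

Lemma ae_eq_law (V V' : T -> R) (S : set R) : measurable S ->
  measurable_fun setT V -> measurable_fun setT V' ->
  (forall A, measurable A -> P (V @^-1` A) = P (V' @^-1` A)) ->
  {ae P, forall w, S (V' w)} -> {ae P, forall w, S (V w)}.
Proof.
move=> mS mV mV' VV' [N [mN N0 SN]].
exists (V @^-1` (~` S)); split => //.
  by rewrite -[X in measurable X]setTI; apply: mV => //; exact: measurableC.
rewrite VV'; last exact: measurableC.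
apply: (subset_measure0 _ mN _ N0) => //.
by rewrite -[X in measurable X]setTI; apply: mV' => //; exact: measurableC.
Qed.

(** Independent stationary increments give the functional equation and stochastic continuity at 0
    gives the limit. [chi] has to be multiplicative only on [S], which carries the process almost
    surely: the naturals for powers [u ^+ n], the half-line for Laplace characters. *)
Lemma levy_csemigroup (X : R -> T -> R) (S : set R) (chi : R -> R[i]) :
  levy_process P X -> measurable S ->
  (forall t, 0 <= t -> {ae P, forall w, S (X t w)}) ->
  bmeas chi -> (forall x, nc (chi x) <= 1) ->
  (forall x y, S x -> S y -> chi (x + y) = chi x * chi y) ->
  (forall e, 0 < e -> exists2 r : R, 0 < r & forall x, `|x| < r -> nc (chi x - 1) <= e) ->
  csemigroup (fun t => cexpectation P (fun w => chi (X t w))).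
Proof.
move=> [mX [X0 _] indX statX contX] mS SX mchi chi1 chiD chi0.
have mXB s t : 0 <= s -> 0 <= t -> measurable_fun setT (fun w => X t w - X s w).
  by move=> s0 t0; apply: measurable_funB; exact: mX.
have bchi s t : 0 <= s -> 0 <= t -> bmeas (fun w => chi (X t w - X s w)).
  by move=> s0 t0; apply: bmeas_comp (mXB _ _ s0 t0) mchi.
split=> [s t s0 t0|].
  have st0 : 0 <= s + t by exact: addr_ge0.
  have sst : s <= s + t by rewrite lerDl.
  have law A : measurable A ->
      P ((fun w => X (s + t) w - X s w) @^-1` A) = P (X t @^-1` A).
    by move=> mA; have := statX s (s + t) A s0 sst mA; rewrite [s + t - s]addrC addKr.
  (* The times 0, s, s + t bound the two increments; later indices repeat the last time. *)
  pose tt j : R := if j is 0%N then 0 else if j is 1%N then s else s + t.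
  have tt0 j : 0 <= tt j by case: j => [|[|]].
  have ttm j : (j < 2)%N -> tt j <= tt j.+1 by case: j => [|[|//]] _ //=; rewrite lerDl.
  have ind := indX 2%N tt (lexx 0) ttm.
  have E2 : cexpectation P (fun w => \prod_(j < 2) chi (X (tt j.+1) w - X (tt j) w)) =
      \prod_(j < 2) cexpectation P (fun w => chi (X (tt j.+1) w - X (tt j) w)).
    apply: (cE_prod_indep _ (fun A => mutually_independentT ind)) => j.
    - by move=> A; apply: sigma_rv_measurable; exact: mXB.
    - exact: bchi.
    - exact: fmeas_comp.
  (* The increment has the law of [X t], so it stays in [S] almost surely even though [S] need not
     be closed under subtraction. *)
  have SXB : {ae P, forall w, S (X (s + t) w - X s w)}.
    by apply: (ae_eq_law mS (mXB _ _ s0 st0) (mX _ t0) law); exact: SX.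
  transitivity (cexpectation P (fun w => \prod_(j < 2) chi (X (tt j.+1) w - X (tt j) w))).
    apply: cE_ae; apply: filterS3 X0 SXB (SX _ s0) => w X0w SXw Ss.
    by rewrite !big_ord_recl big_ord0 /= mulr1 X0w subr0 -chiD// [X s w + _]addrC subrK.
  rewrite E2 !big_ord_recl big_ord0 /= mulr1; congr (_ * _).
    by apply: cE_ae; apply: filterS X0 => w ->; rewrite subr0.
  exact: (cE_eq_law (mXB _ _ s0 st0) (mX _ t0) mchi law).
apply/ccvg_nc/cvgrPdist_le => e e0.
(* Error budget: [e / 2] where the increment is below [r], and at most 2 on the complementary event,
   whose probability is made at most [e / 4]. *)
have e20 : 0 < e / 2 by rewrite divr_gt0.
have [r r0 chir] := chi0 _ e20.
have /fine_cvgP[_ /cvgrPdist_le] := contX 0 r (lexx 0) r0.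
move=> /(_ (e / 4)); rewrite divr_gt0// => /(_ isT) [x x0 Xx].
exists x => // h hx h0; have := Xx h hx (ltW h0).
rewrite !sub0r !normrN (ger0_norm (nc_ge0 _)) ger0_norm ?fine_ge0// => Ph.
set A := [set w | r <= `|X h w - X 0 w|] in Ph.
have mA : measurable A.
  have mN := measurableT_comp (@normr_measurable R setT) (mXB 0 h (lexx 0) (ltW h0)).
  by have := mN measurableT _ (measurable_itv `[r, +oo[); rewrite setTI;
    congr (measurable _); apply/seteqP; split => w /=; rewrite in_itv/= andbT.
have -> : cexpectation P (fun w => chi (X h w)) - 1 =
    cexpectation P (fun w => chi (X h w - X 0 w) - 1).
  rewrite cEB; [|exact: bchi (ltW h0)|exact: bmeas_cst].
  by rewrite cE_cst; congr (_ - _); apply: cE_ae; apply: filterS X0 => w ->; rewrite subr0.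
have fE w : (e / 2 + 2 * \1_A w)%:C = (e / 2)%:C + 2%:C * (\1_A w : R)%:C.
  by apply: eq_ReIm => /=; ring.
have mf : bmeas (fun w => (e / 2 + 2 * \1_A w : R)%:C).
  rewrite (funext fE).
  apply: bmeasD; first exact: bmeas_cst.
  by apply: bmeasM; [exact: bmeas_cst|exact: bmeas_indic].
have : nc (cexpectation P (fun w => chi (X h w - X 0 w) - 1)) <=
    \int[P]_w (e / 2 + 2 * \1_A w).
  apply: ler_nc_cE => // [|w].
    by apply: bmeasB; [exact: bchi (ltW h0)|exact: bmeas_cst].
  rewrite indicE; have [wA|/negP wA] := boolP (w \in A); last first.
    rewrite mulr0 addr0; apply: chir; rewrite ltNge; apply/negP => rX.
    by apply: wA; rewrite inE.
  rewrite mulr1 (le_trans (ler_ncD _ _))// ncN nc1.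
  by have := chi1 (X h w - X 0 w); lra.
move=> /le_trans; apply.
have <- : complex.Re (cexpectation P (fun w => (e / 2 + 2 * \1_A w : R)%:C)) =
  \int[P]_w (e / 2 + 2 * \1_A w) := Re_cE P _.
have -> : cexpectation P (fun w => (e / 2 + 2 * \1_A w : R)%:C) =
    (e / 2)%:C + 2%:C * (fine (P A))%:C.
  rewrite -(cE_indic P mA) -cEZ; last exact: bmeas_indic.
  rewrite -[in RHS](cE_cst P (e / 2)%:C) -cED; last 2 first.
  - exact: bmeas_cst.
  - by apply: bmeasM; [exact: bmeas_cst|exact: bmeas_indic].
  by apply: eq_cE => w; exact: fE.
have {}Ph : fine (P A) <= e / 4 by exact: Ph.
by rewrite /= !mul0r subr0; lra.
Qed.

End levy_character.

(** * Generalized counting processes *)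

Section counting.
Context (R : realType) (d : measure_display) (T : measurableType d).
Variable P : probability T R.

(** Truncation sends negative reals to 0, so the cell of 0 is the whole half-line below 1 and the
    other cells are differences of half-lines. *)
Lemma measurable_truncn_level (k : nat) : measurable ((@Num.trunc R) @^-1` [set k]).
Proof.
have -> : (@Num.trunc R) @^-1` [set k] =
    `]-oo, k.+1%:R[%classic `\` (if k is j.+1 then `]-oo, j.+1%:R[%classic else set0).
  have itvE (x : R) j : `]-oo, j.+1%:R[%classic x <-> (Num.trunc x <= j)%N.
    by rewrite truncn_le_nat /= in_itv.
  apply/seteqP; split => [x /= xk|x [/itvE]].
    split; first by apply/itvE; rewrite xk.
    by case: k xk => [_ []|k xk /itvE]; rewrite xk ltnn.
  rewrite leq_eqVlt => /orP[/eqP//|].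
  by case: k => // k; rewrite ltnS => /itvE.
by apply: measurableD => //; case: k.
Qed.

Lemma counting_csemigroup (N : R -> T -> nat) (u : R[i]) :
  levy_process P (real_process N) -> nc u <= 1 ->
  csemigroup (fun t => cexpectation P (fun w => u ^+ N t w)).
Proof.
(* Truncation extends the character from the naturals to the line; the extension is exactly 1 on
   ]-1, 1[, which settles its continuity at 0. *)
move=> lN u1; pose chi (x : R) := u ^+ Num.trunc x.
have -> : (fun t => cexpectation P (fun w => u ^+ N t w)) =
    (fun t => cexpectation P (fun w => chi (real_process N t w))).
  by apply/funext => t; apply: eq_cE => w; rewrite /chi /real_process natrK.
apply: (levy_csemigroup lN (S := range (fun n : nat => n%:R))).
- apply: countable_measurable; first by move=> x; exact: measurable_set1.
  exact: sub_countable (card_image_le _ _) _.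
- by move=> t _; apply: aeW => w; exists (N t w).
- apply: (bmeas_discrete (f := fun k => u ^+ k) (c := 1)).
    exact: measurable_truncn_level.
  by move=> k; exact: nc_exp_le1.
- by move=> x; exact: nc_exp_le1.
- by move=> _ _ [n _ <-] [m _ <-]; rewrite /chi -natrD !natrK exprD.
- move=> e e0; exists 1 => // x x1; rewrite /chi.
  have /truncn0Pn -> : ~~ (1 <= x) by rewrite -ltNge (le_lt_trans (ler_norm _)).
  by rewrite expr0 subrr nc0 ltW.
Qed.

Lemma counting_measurable (N : R -> T -> nat) (t : R) (k : nat) : levy_process P (real_process N) ->
  0 <= t -> measurable (N t @^-1` [set k]).
Proof.
move=> [mN _ _ _ _] t0; have [B mB <-] := sigma_rv_nat R (N t) [set k].
exact: mN.
Qed.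

Lemma bmeas_counting (N : R -> T -> nat) (t : R) (u : R[i]) : levy_process P (real_process N) ->
  0 <= t -> nc u <= 1 -> bmeas (fun w => u ^+ N t w).
Proof.
move=> lN t0 u1; apply: (bmeas_discrete (f := fun k => u ^+ k) (c := 1)).
  by move=> k; exact: counting_measurable.
by move=> k; exact: nc_exp_le1.
Qed.

(** First-order expansion over the values of [N h]: the value 0 contributes nothing to the mean of
    [u ^+ N h - 1], the values 1 to k contribute their rates, and larger values have probability
    o(h) against a factor of modulus at most 2. *)
Lemma gcp_derive0 (k : nat) (lam : 'I_k -> R) (N : R -> T -> nat) (u : R[i]) :
  generalized_counting_process P lam N -> nc u <= 1 ->
  ccvg (0 : R)^'+ (fun h => (cexpectation P (fun w => u ^+ N h w) - 1) * (h^-1)%:C)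
    (\sum_(j < k) (u ^+ j.+1 - 1) * (lam j)%:C).
Proof.
move=> [lN Nlam Nk] u1.
pose Big h := [set w | (k < N h w)%N].
have mBig h : 0 <= h -> measurable (Big h).
  move=> h0; apply: (measurable_discrete (D := N h) [set n | (k < n)%N]) => n.
  exact: counting_measurable.
have mL h j : 0 <= h -> measurable [set w | N h w = j].
  by move=> h0; exact: (counting_measurable j lN h0).
pose rest h := cexpectation P (fun w => (\1_(Big h) w)%:C * (u ^+ N h w - 1)).
have mu1 h : 0 <= h -> bmeas (fun w => u ^+ N h w - 1).
  by move=> h0; apply: bmeasB; [exact: bmeas_counting|exact: bmeas_cst].
have mrest h : 0 <= h -> bmeas (fun w => (\1_(Big h) w)%:C * (u ^+ N h w - 1)).
  by move=> h0; apply: bmeasM; [apply: bmeas_indic; exact: mBig|exact: mu1].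
have decomp h : 0 <= h -> cexpectation P (fun w => u ^+ N h w) - 1 =
    \sum_(j < k) (u ^+ j.+1 - 1) * (fine (P [set w | N h w = j.+1]))%:C + rest h.
  move=> h0; have mterm (j : 'I_k) :
      bmeas (fun w => (u ^+ j.+1 - 1) * (\1_[set w | N h w = j.+1] w : R)%:C).
    by apply: bmeasM; [exact: bmeas_cst|apply: bmeas_indic; exact: mL].
  transitivity (cexpectation P (fun w => u ^+ N h w - 1)).
    by rewrite cEB ?cE_cst//; [exact: bmeas_counting|exact: bmeas_cst].
  transitivity (cexpectation P (fun w =>
      \sum_(j < k) (u ^+ j.+1 - 1) * (\1_[set w | N h w = j.+1] w)%:C +
      (\1_(Big h) w)%:C * (u ^+ N h w - 1))).
    apply: eq_cE => w; case E : (N h w) => [|n].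
      rewrite expr0 subrr mulr0 addr0 big1// => j _.
      by rewrite indicE memNset ?mulr0//= E.
    rewrite indicE; have [nk|kn] := ltnP n k.
      rewrite memNset; last by rewrite /Big /= E ltnS leqNgt nk.
      rewrite mul0r addr0 (bigD1 (Ordinal nk))//= indicE mem_set//= mulr1.
      rewrite big1 ?addr0// => j /eqP jn; rewrite indicE memNset ?mulr0//= E => -[nj].
      by apply: jn; apply: val_inj.
    rewrite mem_set; last by rewrite /Big /= E ltnS.
    rewrite mul1r big1 ?add0r// => j _; rewrite indicE memNset ?mulr0//= E => -[nj].
    by have := ltn_ord j; rewrite -nj ltnNge kn.
  rewrite cED; last 2 first.
  - exact: bmeas_sum.
  - exact: mrest.
  rewrite cE_sum//; congr (_ + _); apply: eq_bigr => j _.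
  by rewrite cEZ ?cE_indic//; [exact: mL|apply: bmeas_indic; exact: mL].
have restP h : 0 <= h -> nc (rest h) <= 2 * fine (P (Big h)).
  move=> h0; have fE w : (2 * \1_(Big h) w : R)%:C = 2%:C * (\1_(Big h) w : R)%:C.
    by apply: eq_ReIm => /=; ring.
  have -> : 2 * fine (P (Big h)) = \int[P]_w (2 * \1_(Big h) w).
    have <- : complex.Re (cexpectation P (fun w => (2 * \1_(Big h) w : R)%:C)) =
      \int[P]_w (2 * \1_(Big h) w) := Re_cE P _.
    rewrite (eq_cE P fE) cEZ; last by apply: bmeas_indic; exact: mBig.
    by rewrite cE_indic /= ?mul0r ?subr0//; exact: mBig.
  apply: ler_nc_cE => [||w]; first exact: mrest.
    rewrite (funext fE); apply: bmeasM; first exact: bmeas_cst.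
    by apply: bmeas_indic; exact: mBig.
  rewrite ncM nc_real ger0_norm// mulrC ler_wpM2r//.
  rewrite (le_trans (ler_ncD _ _))// ncN nc1.
  by have := nc_exp_le1 (N h w) u1; lra.
have restc : ccvg (0 : R)^'+ (fun h => rest h * (h^-1)%:C) 0.
  apply/ccvg_nc; under eq_fun do rewrite subr0 ncM nc_real.
  apply: (@squeeze_cvgr _ _ _ _ (fun=> 0) (fun h => 2 * (fine (P (Big h)) / h))).
  - near=> h; have h0 : 0 < h by near: h; exact: nbhs_right_gt.
    rewrite mulr_ge0 ?nc_ge0//= mulrA normfV gtr0_norm// ler_wpM2r ?restP ?invr_ge0 ?ltW//.
  - exact: cvg_cst.
  - by rewrite -[X in _ --> X](mulr0 2); apply: (cvgM (cvg_cst _) Nk).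
have key : ccvg (0 : R)^'+ (fun h =>
    \sum_(j < k) (u ^+ j.+1 - 1) * (fine (P [set w | N h w = j.+1]) / h)%:C +
    rest h * (h^-1)%:C) (\sum_(j < k) (u ^+ j.+1 - 1) * (lam j)%:C + 0).
  apply: ccvgD => //; apply: ccvg_sum => j; apply: ccvgM; first exact: ccvg_cst.
  by apply: ccvg_real; exact: Nlam.
rewrite addr0 in key; apply: (ccvg_near_eq _ key).
near=> h; have h0 : 0 < h by near: h; exact: nbhs_right_gt.
rewrite decomp ?ltW// mulrDl mulr_suml; congr (_ + _); apply: eq_bigr => j _.
by rewrite rmorphM mulrA.
Unshelve. all: by end_near. Qed.

(** Both sides are contraction semigroups with the same right derivative at 0. At h = t/(n+1) they
    differ by o(h), hence at [t] by at most (n+1) o(h), which tends to 0. *)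
Lemma gcp_pgf (k : nat) (lam : 'I_k -> R) (N : R -> T -> nat) (u : R[i]) (t : R) :
  (forall j, 0 <= lam j) ->
  generalized_counting_process P lam N -> nc u <= 1 -> 0 <= t ->
  cexpectation P (fun w => u ^+ N t w) =
  cexp (- (t%:C * \sum_(j < k) (lam j)%:C * (1 - u ^+ j.+1))).
Proof.
move=> lam0 gN u1 t0; have [lN _ _] := gN.
set c := \sum_(j < k) _.
have sN := counting_csemigroup lN u1.
have sc := csemigroup_cexp (- c).
rewrite -mulrN.
have [->|tn0] := eqVneq t 0; first by rewrite (csemigroup0 sN) (csemigroup0 sc).
have tp : 0 < t by rewrite lt_neqAle eq_sym tn0.
pose phi h := cexpectation P (fun w => u ^+ N h w).
pose D h := (phi h - cexp (h%:C * - c)) * (h^-1)%:C.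
have cD : ccvg (0 : R)^'+ D 0.
  have d1 := gcp_derive0 gN u1; have d2 := cexp_derive0 (- c).
  have cE : \sum_(j < k) (u ^+ j.+1 - 1) * (lam j)%:C = - c.
    by rewrite /c -sumrN; apply: eq_bigr => j _; rewrite -mulrN opprB mulrC.
  rewrite cE in d1; have d3 : ccvg (0 : R)^'+ (fun h => (phi h - 1) * (h^-1)%:C -
      (cexp (h%:C * - c) - 1) * (h^-1)%:C) (- c - - c) by exact: ccvgB.
  rewrite subrr in d3.
  by apply: (ccvg_near_eq _ d3); apply: nearW => h; rewrite -mulrBl /D /phi; congr (_ * _); ring.
have Rec : complex.Re (- c) <= 0.
  rewrite ReCN oppr_le0 /c Re_sum sumr_ge0// => j _.
  rewrite ReCM /= mul0r subr0 mulr_ge0// ReCB subr_ge0 /=.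
  by rewrite (le_trans (ler_norm _))// (le_trans (ler_Re_nc _))// nc_exp_le1.
have phi1 h : 0 <= h -> nc (phi h) <= 1.
  move=> h0; apply: ler_nc_cE_cst; first exact: bmeas_counting.
  by move=> w; exact: nc_exp_le1.
have e1 (h : R) : 0 <= h -> nc (cexp (h%:C * - c)) <= 1.
  move=> h0; rewrite nc_cexp -expR0 ler_expR ReCM [complex.Re h%:C]/= [complex.Im h%:C]/=.
  by rewrite mul0r subr0 mulr_ge0_le0.
pose h n : R := t / n.+1%:R.
have hp n : 0 < h n by rewrite divr_gt0// ltr0n.
have ht n : n.+1%:R * h n = t by rewrite /h mulrC divfK// pnatr_eq0.
have bound n : nc (phi t - cexp (t%:C * - c)) <= t * nc (D (h n)).
  have := ler_nc_subX n.+1 (phi1 _ (ltW (hp n))) (e1 _ (ltW (hp n))).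
  rewrite -(csemigroupX n.+1 sN (ltW (hp n))) -(csemigroupX n.+1 sc (ltW (hp n))) ht.
  move=> /le_trans; apply; rewrite /D ncM nc_real normfV gtr0_norm//.
  by rewrite -[X in _ <= X * _](ht n) -mulrA [h n * _]mulrCA divff ?mulr1// gt_eqF.
apply: nc_subr_le0.
have hc : nc (D (h n)) @[n --> \oo] --> (0 : R).
  have c0 : nc (D x) @[x --> (0 : R)^'+] --> (0 : R).
    by move/ccvg_nc : cD; under eq_fun do rewrite subr0.
  move/cvg_at_rightP : c0 => /(_ h); apply; split => //.
  by rewrite -[X in _ --> X](mulr0 t); apply: (cvgM (cvg_cst _) cvg_harmonic).
have tc : t * nc (D (h n)) @[n --> \oo] --> (0 : R).
  by rewrite -[X in _ --> X](mulr0 t); apply: (cvgM (cvg_cst _) hc).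
rewrite -(cvg_lim _ tc)//; apply: limr_ge; first by apply/cvg_ex; exists 0.
by near=> n; exact: bound.
Unshelve. all: by end_near. Qed.

End counting.

(** * Gamma processes *)

Section gamma.
Context (R : realType).

(* [Num.max x 0] keeps the character bounded on the whole line. *)
Definition laplace_char (c : R[i]) (x : R) : R[i] := cexp (- ((Num.max x 0)%:C * c)).

Lemma nc_laplace_char_le1 c x : 0 <= complex.Re c -> nc (laplace_char c x) <= 1.
Proof.
move=> c0; rewrite nc_cexp -expR0 ler_expR ReCN ReCM [complex.Re _%:C]/=.
by rewrite [complex.Im _%:C]/= mul0r subr0 oppr_le0 mulr_ge0// le_max lexx orbT.
Qed.

Lemma laplace_charD c x y : 0 <= x -> 0 <= y ->
  laplace_char c (x + y) = laplace_char c x * laplace_char c y.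
Proof.
move=> x0 y0; rewrite /laplace_char !max_l ?addr_ge0// -cexpD.
by rewrite rmorphD mulrDl opprD.
Qed.

Lemma bmeas_laplace_char c : 0 <= complex.Re c -> bmeas (laplace_char c).
Proof.
move=> c0; have mmax : measurable_fun setT (fun x : R => Num.max x 0).
  by apply: measurable_maxr => //; exact: measurable_cst.
have mM b : measurable_fun setT (fun x : R => Num.max x 0 * b).
  by apply: measurable_funM => //; exact: measurable_cst.
have ReE x : complex.Re (- ((Num.max x 0)%:C * c)) = Num.max x 0 * - complex.Re c.
  by rewrite ReCN ReCM /= mul0r subr0 mulrN.
have ImE x : complex.Im (- ((Num.max x 0)%:C * c)) = Num.max x 0 * - complex.Im c.
  by rewrite ImCN ImCM /= mul0r addr0 mulrN.
split.
- under eq_fun do rewrite Re_cexp ReE ImE.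
  apply: measurable_funM.
    exact: (measurableT_comp (continuous_measurable_fun (@continuous_expR R)) (mM _)).
  exact: (measurableT_comp (continuous_measurable_fun (@continuous_cos R)) (mM _)).
- under eq_fun do rewrite Im_cexp ReE ImE.
  apply: measurable_funM.
    exact: (measurableT_comp (continuous_measurable_fun (@continuous_expR R)) (mM _)).
  exact: (measurableT_comp (continuous_measurable_fun (@continuous_sin R)) (mM _)).
- by exists 1 => x; exact: nc_laplace_char_le1.
Qed.

Lemma ccvg_laplace_char (U : Type) (F : set_system U) {FF : Filter F}
    (f : U -> R[i]) (g : U -> R) (c : R[i]) (x : R) :
  ccvg F f c -> g y @[y --> F] --> x ->
  ccvg F (fun y => laplace_char (f y) (g y)) (laplace_char c x).
Proof.
move=> fc gx; apply: ccvg_cexp; apply: ccvgN; apply: ccvgM => //.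
apply: ccvg_real; rewrite maxr_absE; under eq_fun do rewrite maxr_absE.
apply: cvgM; last exact: cvg_cst.
apply: cvgD; first by apply: cvgD => //; exact: cvg_cst.
by apply: cvg_norm; apply: cvgB => //; exact: cvg_cst.
Qed.

Lemma laplace_char0 c : laplace_char c 0 = 1.
Proof. by rewrite /laplace_char max_l// mul0r oppr0 cexp0. Qed.

Context (d : measure_display) (T : measurableType d) (P : probability T R).

Lemma gamma_process_ge0 (lambda a : R) (Z : R -> T -> R) t :
  gamma_process P lambda a Z -> 0 <= t -> {ae P, forall w, 0 <= Z t w}.
Proof.
move=> [[mZ [Z0 _] _ _ _] lawZ]; rewrite le_eqVlt => /predU1P[<-|t0].
  by apply: filterS Z0 => w ->.
exists (Z t @^-1` `]-oo, 0[); split.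
- by rewrite -[X in measurable X]setTI; apply: mZ => //; exact: ltW.
- rewrite lawZ//; apply: integral0_eq => x /=; rewrite in_itv/= => x0.
  by rewrite /gamma_pdf ltNge ltW.
- by move=> w /= /negP; rewrite -ltNge in_itv.
Qed.

Lemma gamma_csemigroup (lambda a : R) (Z : R -> T -> R) (c : R[i]) :
  gamma_process P lambda a Z -> 0 <= complex.Re c ->
  csemigroup (fun t => cexpectation P (fun w => laplace_char c (Z t w))).
Proof.
move=> gZ c0; apply: (levy_csemigroup gZ.1 (S := `[0, +oo[%classic)).
- by [].
- move=> t t0; apply: filterS (gamma_process_ge0 gZ t0) => w.
  by rewrite /= in_itv/= andbT.
- exact: bmeas_laplace_char.
- by move=> x; exact: nc_laplace_char_le1.
- by move=> x y /=; rewrite !in_itv/= !andbT; exact: laplace_charD.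
- move=> e e0.
  have : ccvg (nbhs (0 : R)) (laplace_char c) 1.
    by rewrite -(laplace_char0 c); apply: ccvg_laplace_char; [exact: ccvg_cst|exact: cvg_id].
  move=> /ccvg_nc/cvgrPdist_le/(_ _ e0)[r /= r0 H]; exists r => // x xr.
  have := H x; rewrite /ball_ /= !sub0r !normrN => /(_ xr).
  by rewrite ger0_norm// nc_ge0.
Qed.

Lemma gamma_function1 : gamma_function (1 : R) = 1.
Proof.
rewrite /gamma_function /Rintegral.
have -> : (\int[lebesgue_measure]_(x in `]0%R, +oo[) (x `^ (1 - 1) * expR (- x))%:E =
    \int[lebesgue_measure]_x (exponential_pdf 1 x)%:E :> \bar R)%E; last first.
  by rewrite integral_exponential_pdf.
transitivity (\int[lebesgue_measure]_(x in `]0%R, +oo[) (exponential_pdf 1 x)%:E :> \bar R)%E.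
  apply: eq_integral => x; rewrite inE/= in_itv/= andbT => x0.
  by rewrite exponential_pdfE ?ltW// subrr powRr0 !mul1r mulN1r.
rewrite integral_itv_obnd_cbnd; last first.
  apply: measurable_funTS; apply/measurable_EFinP; exact: measurable_exponential_pdf.
rewrite integral_mkcond; apply: eq_integral => x _; rewrite patchE.
case: ifPn => //; rewrite notin_setE/= in_itv/= andbT => /negP; rewrite -ltNge => x0.
by rewrite lt0_exponential_pdf.
Qed.

Lemma gamma_pdf1_lt (a x : R) : 0 < a -> 0 < x ->
  (\int[lebesgue_measure]_(y in `]-oo, x[) (gamma_pdf 1 a y)%:E = (1 - expR (- (a * x)))%:E)%E.
Proof.
move=> a0 x0.
transitivity (\int[lebesgue_measure]_(y in `]0%R, x[) (exponential_pdf a y)%:E)%E.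
  rewrite integral_mkcond [RHS]integral_mkcond; apply: eq_integral => y _.
  rewrite !patchE /gamma_pdf; have [y0|y0] := ltP 0 y.
    have -> : (y \in `]-oo, x[%classic) = (y \in `]0, x[%classic).
      by apply/idP/idP; rewrite !inE/= !in_itv/= ?y0.
    case: ifP => // _; rewrite exponential_pdfE ?ltW// powRr1 ?ltW// subrr powRr0 gamma_function1.
    by rewrite divr1 mulr1 mulNr.
  rewrite [in RHS]ifF; first by case: ifP.
  by apply/negP; rewrite inE/= in_itv/= ltNge y0.
have mE (D : set R) : measurable_fun D (fun y => (exponential_pdf a y)%:E).
  apply: measurable_funTS; apply/measurable_EFinP; exact: measurable_exponential_pdf.
rewrite -(@integral_itv_bndoo _ _ _ _ true false)//.
have := exponential_prob_itv0c a x0; rewrite /exponential_prob => ->.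
by rewrite mulNr EFinB.
Qed.

(** [Y] rounded down to mesh h is h times a geometric variable with ratio exp(-ah). Its generating
    function at z = exp(-hc) satisfies E z^K (1 - exp(-h(a+c))) = 1 - exp(-ha); dividing by h and
    letting h tend to 0 gives the claim at complex [c] from the real distribution function alone. *)
Lemma cE_exponential (Y : T -> R) (a : R) (c : R[i]) : measurable_fun setT Y ->
  0 < a -> 0 <= complex.Re c ->
  (forall x, 0 < x -> P (Y @^-1` `]-oo, x[) = (1 - expR (- (a * x)))%:E) ->
  cexpectation P (fun w => laplace_char c (Y w)) * (a%:C + c) = a%:C.
Proof.
move=> mY a0 c0 lawY.
pose h n : R := n.+1%:R^-1.
have hp n : 0 < h n by rewrite invr_gt0 ltr0n.
have hN n : h n * n.+1%:R = 1 by rewrite mulVf ?pnatr_eq0.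
pose K n w := Num.trunc (Y w * n.+1%:R).
pose p n := expR (- (a * h n)).
pose z n := cexp (- ((h n)%:C * c)).
have p01 n : 0 <= p n < 1 by rewrite expR_ge0 -expR0 ltr_expR oppr_lt0 mulr_gt0.
have z1 n : nc (z n) <= 1.
  rewrite nc_cexp -expR0 ler_expR ReCN ReCM [complex.Re _%:C]/= [complex.Im _%:C]/=.
  by rewrite mul0r subr0 oppr_le0 mulr_ge0// ltW.
have KleE n k : [set w | (K n w <= k)%N] = Y @^-1` `]-oo, k.+1%:R * h n[.
  apply/seteqP; split => w /=; rewrite in_itv/= /K truncn_le_nat ltr_pdivlMr ?ltr0n//.
have mKle n k : measurable [set w | (K n w <= k)%N].
  by rewrite KleE -[X in measurable X]setTI; exact: mY.
have PKle n k : P [set w | (K n w <= k)%N] = (1 - p n ^+ k.+1)%:E.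
  rewrite KleE lawY ?mulr_gt0 ?ltr0n//; congr (1 - _)%:E.
  by rewrite /p -expRM_natl; congr expR; ring.
have KE n k : K n @^-1` [set k] = [set w | (K n w <= k)%N] `\`
    (if k is j.+1 then [set w | (K n w <= j)%N] else set0).
  apply/seteqP; split => [w /= Kk|w [/=]].
    rewrite Kk; split => //; case: k Kk => [_ []|k Kk] /=.
    by rewrite Kk ltnn.
  by case: k => [|k]; [rewrite leqn0 => /eqP|rewrite leq_eqVlt ltnS => /orP[/eqP|]].
have mK n k : measurable (K n @^-1` [set k]).
  by rewrite KE; apply: measurableD => //; case: k.
have PK n k : P (K n @^-1` [set k]) = ((1 - p n) * p n ^+ k)%:E.
  rewrite KE measureD//; last 2 first.
  - by case: k.
  - by rewrite ltey_eq fin_num_measure.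
  case: k => [|k].
    by rewrite setI0 measure0 sube0; have := PKle n 0%N; rewrite expr1 expr0 mulr1.
  rewrite (_ : _ `&` _ = [set w | (K n w <= k)%N]); last first.
    by apply/seteqP; split => w /= => [[]//|Kk]; split => //; exact: leqW.
  transitivity ((1 - p n ^+ k.+2)%:E - (1 - p n ^+ k.+1)%:E)%E; first by rewrite -!PKle.
  by rewrite -EFinB; congr (_%:E); rewrite !exprS; ring.
have geo n := cE_geometric (p01 n) (z1 n) (mK n) (PK n).
(* Negative values truncate to 0, in accordance with the [Num.max] in [laplace_char]. *)
have Kc w : (K n w)%:R * h n @[n --> \oo] --> Num.max (Y w) 0.
  apply/cvgrPdist_le => e e0; near=> n.
  apply: (@le_trans _ _ (h n)); last first.
    near: n; have /cvgrPdist_le/(_ _ e0) := @cvg_harmonic R; apply: filterS => n.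
    by rewrite sub0r normrN ger0_norm// harmonic_ge0.
  rewrite /K; have [Y0|Y0] := leP 0 (Y w).
    have /truncn_itv/andP[] : 0 <= Y w * n.+1%:R by rewrite mulr_ge0.
    set m := Num.trunc _; rewrite -ler_pdivrMr ?ltr0n// -ltr_pdivlMr ?ltr0n//.
    rewrite -/(h n) -natr1 mulrDl mul1r => m1 m2.
    by rewrite ler_norml; apply/andP; split; lra.
  have /truncn0Pn -> : ~~ (1 <= Y w * n.+1%:R).
    rewrite -ltNge (@lt_trans _ _ 0)// pmulr_llt0// ltr0n.
  by rewrite mul0r subrr normr0 ltW.
have cE1 : ccvg \oo (fun n => cexpectation P (fun w => z n ^+ K n w))
    (cexpectation P (fun w => laplace_char c (Y w))).
  apply: (cE_cvg P (c := 1)) => [n|n w|w].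
  - apply: (bmeas_discrete (f := fun k => z n ^+ k) (c := 1)) => // k.
    exact: nc_exp_le1.
  - exact: nc_exp_le1.
  - rewrite /laplace_char; have H : ccvg \oo (fun n => cexp (- (((K n w)%:R * h n)%:C * c)))
        (cexp (- ((Num.max (Y w) 0)%:C * c))).
      by apply: ccvg_cexp; apply: ccvgN; apply: ccvgM; [exact: ccvg_real|exact: ccvg_cst].
    apply: (ccvg_near_eq _ H); apply: nearW => n; rewrite /z -cexpMn; congr cexp.
    by rewrite rmorphM rmorph_nat -[RHS]mulr_natl mulrN mulrA.
have h0 : h n @[n --> \oo] --> (0 : R) by exact: cvg_harmonic.
have dE (b : R[i]) : ccvg \oo (fun n => (1 - cexp (- ((h n)%:C * b))) * ((h n)^-1)%:C) b.
  have H : ccvg \oo (fun n => - ((cexp ((h n)%:C * - b) - 1) * ((h n)^-1)%:C)) (- - b).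
    by apply: ccvgN; exact: (ccvg_at_right_seq (cexp_derive0 (- b)) hp h0).
  rewrite -[X in ccvg _ _ X](opprK b); apply: (ccvg_near_eq _ H); apply: nearW => n.
  by rewrite -mulNr opprB mulrN.
have lhs : ccvg \oo (fun n => cexpectation P (fun w => z n ^+ K n w) *
    ((1 - cexp (- ((h n)%:C * (a%:C + c)))) * ((h n)^-1)%:C))
    (cexpectation P (fun w => laplace_char c (Y w)) * (a%:C + c)).
  exact: ccvgM.
apply: (ccvg_unique lhs); apply: (ccvg_near_eq _ (dE a%:C)); apply: nearW => n.
rewrite mulrA; congr (_ * _).
have pE : cexp (- ((h n)%:C * a%:C)) = (p n)%:C.
  by rewrite -rmorphM -rmorphN cexp_real /p [h n * a]mulrC.
rewrite pE -(geo n); congr (_ * (1 - _)).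
by rewrite mulrDr opprD cexpD pE.
Unshelve. all: by end_near. Qed.

End gamma.

(** * Continuous logarithms *)

Section clog.
Context (R : realType).
Implicit Types z : R[i].

(* A logarithm on [Re z > 0] only: [atan] ignores the quadrant. *)
Definition clog z : R[i] := ln (nc z) +i* atan (complex.Im z / complex.Re z).

Lemma cexp_clog z : 0 < complex.Re z -> cexp (clog z) = z.
Proof.
case: z => x y /= x0; set t := y / x.
have nz : 0 < nc (x +i* y).
  by rewrite lt_neqAle nc_ge0 andbT eq_sym nc_eq0; apply/eqP => -[x00]; rewrite x00 ltxx in x0.
have nE : nc (x +i* y) = x * Num.sqrt (1 + t ^+ 2).
  rewrite -[X in _ = X * _](gtr0_norm x0) -sqrtr_sqr -sqrtrM ?sqr_ge0//=; congr Num.sqrt.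
  by rewrite /t; field; rewrite gt_eqF.
have s0 : 0 < Num.sqrt (1 + t ^+ 2).
  by rewrite sqrtr_gt0 (lt_le_trans ltr01)// lerDl sqr_ge0.
have ct : nc (x +i* y) * cos (atan t) = x.
  by rewrite cos_atan nE mulfK// gt_eqF.
have c0 : cos (atan t) != 0 by rewrite cos_atan invr_neq0// gt_eqF.
have st : sin (atan t) = t * cos (atan t).
  by rewrite -{2}(atanK t) /tan divfK.
apply: eq_ReIm; rewrite ?Re_cexp ?Im_cexp [complex.Re (clog _)]/= [complex.Im (clog _)]/=.
  by rewrite lnK.
by rewrite lnK// -/t st mulrCA ct /t divfK// gt_eqF.
Qed.

Lemma clog1 : clog 1 = 0.
Proof. by rewrite /clog nc1 ln1 /= mul0r atan0. Qed.

Lemma ccvg_clog (U : Type) (F : set_system U) {FF : Filter F} (f : U -> R[i]) l :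
  0 < complex.Re l -> ccvg F f l -> ccvg F (fun x => clog (f x)) (clog l).
Proof.
move=> l0 fl; have [fr fi] := fl.
have l0' : 0 < nc l by rewrite (lt_le_trans l0)// (le_trans (ler_norm _))// ler_Re_nc.
have cn : nc (f x) @[x --> F] --> nc l.
  have /ccvg_nc/cvgrPdist_le H := fl; apply/cvgrPdist_le => e /H.
  apply: filterS => x; rewrite sub0r normrN ger0_norm ?nc_ge0//; apply: le_trans.
  have A := ler_ncD (f x - l) l; have B := ler_ncD (l - f x) (f x).
  rewrite !subrK in A B; rewrite (nc_distC l) in B.
  by rewrite ler_norml; apply/andP; split; lra.
split.
- change (ln (nc (f x)) @[x --> F] --> ln (nc l)).
  by apply: continuous_cvg => //; exact: continuous_ln.
- change (atan (complex.Im (f x) / complex.Re (f x)) @[x --> F] -->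
    atan (complex.Im l / complex.Re l)).
  apply: continuous_cvg; first exact: continuous_atan.
  by apply: cvgM => //; apply: cvgV => //; rewrite gt_eqF.
Qed.

End clog.

Section continuous_log.
Context (R : realType) (q : nat).

(** Sequential form of continuity on the polydisc: a neighbourhood of a row vector is a product of
    neighbourhoods of its finitely many entries. *)
Lemma ccvg_continuous_log (w L : 'rV[R[i]]_q -> R[i]) (v : nat -> 'rV[R[i]]_q) u :
  continuous_log w L -> (forall n, polydisc (v n)) -> polydisc u ->
  (forall i, ccvg \oo (fun n => v n 0 i) (u 0 i)) ->
  ccvg \oo (fun n => L (v n)) (L u).
Proof.
move=> [cL _ _] pv pu vu; apply/ccvgP.
move/subspace_continuousP : cL => /(_ u pu); apply: cvg_trans.
move=> A /=; rewrite /nbhs/= => -[Q nQ QA].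
have : \forall n \near \oo, forall i j, Q i j (v n i j).
  apply: filter_forall => i; apply: filter_forall => j.
  rewrite ord1; have /ccvgP := vu j; apply.
  by have := nQ i j; rewrite ord1.
by apply: filterS => n Qn; apply: QA.
Qed.

Lemma within_continuous_ccvg (L : 'rV[R[i]]_q -> R[i]) :
  (forall u, polydisc u ->
    ccvg (within (@polydisc R q) (nbhs (u : 'rV[R[i]^o]_q))) L (L u)) ->
  {within (@polydisc R q : set 'rV[R[i]^o]_q),
         continuous (L : 'rV[R[i]^o]_q -> R[i]^o)}.
Proof. by move=> H; apply/subspace_continuousP => u /H /ccvgP. Qed.

Lemma ccvg_coord (u : 'rV[R[i]]_q) i :
  ccvg (within (@polydisc R q) (nbhs (u : 'rV[R[i]^o]_q))) (fun v => v 0 i) (u 0 i).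
Proof.
apply/ccvgP; apply: cvg_within_filter => A nA.
exists (fun i0 j0 => if (i0 == 0) && (j0 == i) then A else setT).
  move=> i0 j0; case: ifP => [/andP[/eqP -> /eqP ->]//|_]; exact: filterT.
by move=> M /= /(_ 0 i); rewrite !eqxx.
Qed.

End continuous_log.

(** * The fraction w and its continuous logarithm *)

Section pgf_base.
Context (R : realType) (q : nat) (k : 'I_q -> nat).
Variables (lam : forall i : 'I_q, 'I_(k i) -> R) (theta : R) (a : 'I_q -> R).
Arguments lam : clear implicits.
Hypothesis lam0 : forall (i : 'I_q) (j : 'I_(k i)), 0 <= lam i j.
Hypothesis theta01 : 0 < theta < 1.
Hypothesis a0 : forall i, 0 < a i.
Implicit Types u : 'rV[R[i]]_q.

Definition gcp_exponent u (i : 'I_q) : R[i] :=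
  \sum_(j < k i) (lam i j)%:C * (1 - u 0 i ^+ j.+1).

(** With c_i = [gcp_exponent u i] this is 1 + c_i / a_i, the inverse of the Laplace transform at c_i
    of the exponential law of rate [a i]. *)
Definition pgf_factor u (i : 'I_q) : R[i] :=
  1 + \sum_(j < k i) (lam i j / a i)%:C * (1 - u 0 i ^+ j.+1).

Lemma polydisc_nc u i : polydisc u -> nc (u 0 i) <= 1.
Proof. by move=> /(_ i); rewrite norm_nc lecR. Qed.

Lemma Re_gcp_exponent_ge0 u i : polydisc u -> 0 <= complex.Re (gcp_exponent u i).
Proof.
move=> pu; rewrite /gcp_exponent Re_sum sumr_ge0// => j _.
rewrite ReCM /= mul0r subr0 mulr_ge0// ReCB subr_ge0 /=.
by rewrite (le_trans (ler_norm _))// (le_trans (ler_Re_nc _))// nc_exp_le1// polydisc_nc.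
Qed.

Lemma pgf_factorE u i : (a i)%:C * pgf_factor u i = (a i)%:C + gcp_exponent u i.
Proof.
rewrite /pgf_factor mulrDr mulr1; congr (_ + _); rewrite mulr_sumr.
apply: eq_bigr => j _; rewrite mulrA -rmorphM; congr (_%:C * _).
by rewrite mulrCA divff ?mulr1// gt_eqF.
Qed.

(** Each 1 - u^j has nonnegative real part. This puts every factor in the domain of [clog] and keeps
    the modulus of the product at least 1, above [theta]. *)
Lemma Re_pgf_factor u i : polydisc u -> 1 <= complex.Re (pgf_factor u i).
Proof.
move=> pu; rewrite /pgf_factor ReCD /= lerDl Re_sum sumr_ge0// => j _.
rewrite ReCM /= mul0r subr0 mulr_ge0 ?(divr_ge0 _ (ltW (a0 i)))// ReCB subr_ge0 /=.
by rewrite (le_trans (ler_norm _))// (le_trans (ler_Re_nc _))// nc_exp_le1// polydisc_nc.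
Qed.

Lemma nc_pgf_factor u i : polydisc u -> 1 <= nc (pgf_factor u i).
Proof.
move=> pu; rewrite (le_trans (Re_pgf_factor i pu))//.
by rewrite (le_trans (ler_norm _))// ler_Re_nc.
Qed.

Lemma pgf_factor_neq0 u i : polydisc u -> pgf_factor u i != 0.
Proof. by move=> /(nc_pgf_factor i) v1; rewrite -nc_eq0 gt_eqF// (lt_le_trans ltr01). Qed.

Lemma nc_prod_pgf_factor u : polydisc u -> 1 <= nc (\prod_i pgf_factor u i).
Proof.
move=> pu; rewrite nc_prod; apply: (big_ind (fun x : R => 1 <= x)) => //.
  by move=> x y; exact: mulr_ege1.
by move=> i _; exact: nc_pgf_factor.
Qed.

(** With V the product of the factors, w = (1 - theta) V^-1 / (1 - theta V^-1): the geometric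
    generating function at z = V^-1, times z. The denominator V - theta is nonzero because |V| is at
    least 1. *)
Lemma pgf_baseE u : polydisc u ->
  pgf_base lam theta a u * (1 - theta%:C * (\prod_i pgf_factor u i)^-1) =
  (1 - theta%:C) * (\prod_i pgf_factor u i)^-1.
Proof.
move=> pu; rewrite /pgf_base -/(pgf_factor u _); set V := \prod_i _.
have V1 := nc_prod_pgf_factor pu.
have V0 : V != 0 by rewrite -nc_eq0 gt_eqF// (lt_le_trans ltr01).
have Vt : V - theta%:C != 0.
  apply: contraTneq V1 => /eqP; rewrite subr_eq0 -/V => /eqP ->.
  by rewrite nc_real -ltNge gtr0_norm; case/andP: theta01.
by field; rewrite V0.
Qed.

Lemma ccvg_pgf_factor (U : Type) (F : set_system U) {FF : Filter F}
  (f : U -> 'rV[R[i]]_q) u i : ccvg F (fun x => f x 0 i) (u 0 i) ->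
  ccvg F (fun x => pgf_factor (f x) i) (pgf_factor u i).
Proof.
move=> fu; apply: ccvgD; first exact: ccvg_cst.
apply: ccvg_sum => j; apply: ccvgM; first exact: ccvg_cst.
by apply: ccvgB; [exact: ccvg_cst|exact: ccvgX].
Qed.

Lemma ccvg_gcp_exponent (U : Type) (F : set_system U) {FF : Filter F}
  (f : U -> 'rV[R[i]]_q) u i : ccvg F (fun x => f x 0 i) (u 0 i) ->
  ccvg F (fun x => gcp_exponent (f x) i) (gcp_exponent u i).
Proof.
move=> fu; apply: ccvg_sum => j; apply: ccvgM; first exact: ccvg_cst.
by apply: ccvgB; [exact: ccvg_cst|exact: ccvgX].
Qed.

(* [1 - theta / prod_i v_i] has positive real part although [prod_i v_i] may
   wind around the origin, so principal logarithms suffice. *)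
Lemma continuous_log_pgf_base : exists L, continuous_log (pgf_base lam theta a) L.
Proof.
have [t0 t1] := andP theta01.
pose S u := \sum_i clog (pgf_factor u i).
pose W u := 1 - theta%:C * cexp (- S u).
have ReV u i : polydisc u -> 0 < complex.Re (pgf_factor u i).
  by move=> /(Re_pgf_factor i); apply: lt_le_trans.
have cS u : polydisc u -> cexp (- S u) = (\prod_i pgf_factor u i)^-1.
  move=> pu; rewrite cexpN cexp_sum; congr (_^-1); apply: eq_bigr => i _.
  by rewrite cexp_clog// ReV.
have ReW u : polydisc u -> 0 < complex.Re (W u).
  move=> pu; rewrite ReCB subr_gt0 (le_lt_trans (ler_norm _))//.
  rewrite (le_lt_trans (ler_Re_nc _))// ncM nc_real gtr0_norm// cS//.
  have V1 := nc_prod_pgf_factor pu.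
  rewrite ComplexField.Normc.normcV (le_lt_trans _ t1)// ler_piMr ?(ltW t0)//.
  by rewrite invf_le1// (lt_le_trans ltr01).
have Re1t : 0 < complex.Re (1 - theta%:C) by rewrite /= subr_gt0.
(* Read off from w = (1 - theta) exp(-S) / W. At (1, ..., 1) one has S = 0 and W = 1 - theta, which
   gives the normalization. *)
exists (fun u => clog (1 - theta%:C) - S u - clog (W u)); split.
- apply: within_continuous_ccvg => u pu.
  have cSS : ccvg (within (@polydisc R q) (nbhs (u : 'rV[R[i]^o]_q))) S (S u).
    apply: ccvg_sum => i; apply: ccvg_clog; first exact: ReV.
    by apply: ccvg_pgf_factor; exact: ccvg_coord.
  apply: ccvgB; first by apply: ccvgB => //; exact: ccvg_cst.
  apply: ccvg_clog; first exact: ReW.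
  apply: ccvgB; first exact: ccvg_cst.
  apply: ccvgM; first exact: ccvg_cst.
  by apply: ccvg_cexp; exact: ccvgN.
- move=> u pu; rewrite !cexpB cexp_clog// cexp_clog ?ReW// /W cS//.
  have WV0 : 1 - theta%:C * (\prod_i pgf_factor u i)^-1 != 0.
    rewrite -cS// -/(W u); apply: contraTneq (ReW u pu) => ->.
    by rewrite ltxx.
  apply: (mulIf WV0); rewrite pgf_baseE// mulfVK//.
  by rewrite -cexpN cS.
- have v1 i : pgf_factor (const_mx 1) i = 1.
    rewrite /pgf_factor big1 ?addr0// => j _.
    by rewrite mxE expr1n subrr mulr0.
  have S1 : S (const_mx 1) = 0 by rewrite /S big1// => i _; rewrite v1 clog1.
  by rewrite /W S1 oppr0 cexp0 mulr1 addr0 subrr.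
Qed.

End pgf_base.

(** * Subordination *)

Section sigma.
Context (R : realType) (d : measure_display) (T : measurableType d).
Variable P : probability T R.

Lemma sigma_process_measurable (X : R -> T -> R) A :
  (forall t, 0 <= t -> measurable_fun setT (X t)) -> sigma_process X A -> measurable A.
Proof.
move=> mX; apply: smallest_sub; first exact: sigma_algebra_measurable.
by move=> B [t t0 XB]; apply: sigma_rv_measurable XB; exact: mX.
Qed.

Lemma sigma_processes_measurable (I : Type) (X : I -> R -> T -> R) A :
  (forall i t, 0 <= t -> measurable_fun setT (X i t)) ->
  sigma_processes X A -> measurable A.
Proof.
move=> mX; apply: smallest_sub; first exact: sigma_algebra_measurable.
by move=> B [i [t t0 XB]]; apply: sigma_rv_measurable XB; exact: mX.
Qed.

Lemma sigma_rv_process (X : R -> T -> R) t : 0 <= t ->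
  sigma_rv (X t) `<=` sigma_process X.
Proof. by move=> t0 A XA; apply: sub_gen_smallest; exists t. Qed.

Lemma sigma_rv_processes (I : Type) (X : I -> R -> T -> R) i t : 0 <= t ->
  sigma_rv (X i t) `<=` sigma_processes X.
Proof. by move=> t0 A XA; apply: sub_gen_smallest; exists i, t. Qed.

Lemma sigma_bigcap (I : finType) (G : set (set T)) (A : I -> set T) :
  (forall i, <<s G >> (A i)) -> <<s G >> (\bigcap_i A i).
Proof.
move=> GA; apply: (@fin_bigcap_measurable _ (g_sigma_algebraType G)) => [|i _].
  exact: finite_finset.
exact: GA.
Qed.

Lemma prod_option (K : comNzRingType) (I : finType) (F : option I -> K) :
  \prod_o F o = F None * \prod_i F (Some i).
Proof.
rewrite (bigD1 None)//=; congr (_ * _).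
rewrite (reindex_omap Some id)/=; last by case.
by apply: eq_bigl => i; rewrite /= eqxx.
Qed.

Lemma prod_option_ereal (I : finType) (F : option I -> \bar R) :
  (\prod_o F o = F None * \prod_i F (Some i))%E.
Proof.
rewrite (bigD1 None)//=; congr (_ * _)%E.
rewrite (reindex_omap Some id)/=; last by case.
by apply: eq_bigl => i; rewrite /= eqxx.
Qed.

Lemma bigcap_option (I : finType) (A : option I -> set T) :
  \bigcap_o A o = (\bigcap_i A (Some i)) `&` A None.
Proof.
apply/seteqP; split => [w Aw|w [Aw An]]; first by split => [i _|]; exact: Aw.
by case => [i|] _ //; exact: Aw.
Qed.

Lemma fmeas_indic (F : set (set T)) (S : set T) : F S -> F (~` S) -> F setT -> F set0 ->
  fmeas F (fun w => (\1_S w : R)%:C).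
Proof.
move=> FS FSC FT F0 A mA; split.
  by rewrite preimage_indic; do 2 case: ifP => _.
have [A00|A00] := pselect (A 0).
  by rewrite (_ : _ @^-1` _ = setT)//; apply/seteqP; split.
by rewrite (_ : _ @^-1` _ = set0)//; apply/seteqP; split.
Qed.

Lemma fmeas_indic_smallest (G : set (set T)) (S : set T) : <<s G >> S ->
  fmeas <<s G >> (fun w => (\1_S w : R)%:C).
Proof.
move=> GS; apply: fmeas_indic => //.
- exact: (@measurableC _ (g_sigma_algebraType G)).
- exact: (@measurableT _ (g_sigma_algebraType G)).
- exact: (@measurable0 _ (g_sigma_algebraType G)).
Qed.

End sigma.

Section subordination.
Context (R : realType) (d : measure_display) (T : measurableType d).
Variable P : probability T R.
Context (q : nat) (lambda theta : R) (a : 'I_q -> R).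
Variables (Z : 'I_q -> R -> T -> R) (B : R -> T -> nat).
Hypotheses (lambda0 : 0 < lambda).
Hypothesis hZ : forall i, gamma_process P lambda (a i) (Z i).
Hypothesis hB : negative_binomial_process P theta B.
Hypothesis hZBind : mutually_independent P
       (fun o : option 'I_q =>
          if o is Some i then sigma_process (Z i)
          else sigma_process (real_process B)).
Local Notation G := (gamma_subordinator lambda Z B).

Lemma gamma_measurable i (t : R) : 0 <= t -> measurable_fun setT (Z i t).
Proof. by case: (hZ i) => -[mZ _ _ _ _] _; exact: mZ. Qed.

Lemma shifted_time_ge0 (t : R) (n : nat) : 0 <= t -> 0 <= t + lambda^-1 * n%:R.
Proof. by move=> t0; rewrite addr_ge0// mulr_ge0// invr_ge0 ltW. Qed.

Lemma subordinator_measurable i (t : R) : 0 <= t -> measurable_fun setT (G i t).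
Proof.
move=> t0 _ A mA; rewrite setTI.
have -> : G i t @^-1` A = \bigcup_n ((B (lambda * t) @^-1` [set n]) `&`
    (Z i (t + lambda^-1 * n%:R) @^-1` A)).
  apply/seteqP; split => [w Gw|w [n _ [/= Bn]]].
    by exists (B (lambda * t) w).
  by rewrite /preimage /= /gamma_subordinator Bn.
apply: bigcupT_measurable => n; apply: measurableI.
  by apply: (counting_measurable (P := P)) (hB.1) _; rewrite mulr_ge0// ltW.
rewrite -[X in measurable X]setTI; apply: gamma_measurable => //.
exact: shifted_time_ge0.
Qed.

(** The random time takes values in the countable set of the t + n/lambda, so one null set serves
    for all of them. *)
Lemma subordinator_ge0 i (t : R) : 0 <= t -> {ae P, forall w, 0 <= G i t w}.
Proof.
move=> t0; have := ae_foralln (fun n => gamma_process_ge0 (hZ i) (shifted_time_ge0 n t0)).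
by apply: filterS => w; apply.
Qed.

Lemma cE_subordinator (c : 'I_q -> R[i]) (t : R) :
  (forall i, 0 <= complex.Re (c i)) -> 0 <= t ->
  cexpectation P (fun w => \prod_i laplace_char (c i) (G i t w)) =
  (\prod_i cexpectation P (fun w => laplace_char (c i) (Z i t w))) *
  cexpectation P (fun w =>
    (\prod_i cexpectation P (fun w => laplace_char (c i) (Z i lambda^-1 w))) ^+ B (lambda * t) w).
Proof.
move=> c0 t0.
have lt0 : 0 <= lambda * t by rewrite mulr_ge0// ltW.
pose g i s := cexpectation P (fun w => laplace_char (c i) (Z i s w)).
have sg i : csemigroup (g i) by exact: gamma_csemigroup (hZ i) (c0 i).
have bL i (V : T -> R) : measurable_fun setT V -> bmeas (fun w => laplace_char (c i) (V w)).
  by move=> mV; apply: bmeas_comp => //; exact: bmeas_laplace_char.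
have bZ i s : 0 <= s -> bmeas (fun w => laplace_char (c i) (Z i s w)).
  by move=> s0; apply: bL; exact: gamma_measurable.
have mB n : measurable (B (lambda * t) @^-1` [set n]) by exact: counting_measurable hB.1 lt0.
have z1 : nc (\prod_i g i lambda^-1) <= 1.
  apply: prod_nc_le1 => i _; apply: ler_nc_cE_cst.
    by apply: bZ; rewrite invr_ge0 ltW.
  by move=> w; exact: nc_laplace_char_le1.
rewrite -/(g _ t) -cEZ; last exact: bmeas_counting hB.1 lt0 z1.
apply: (cE_partition mB).
- by apply: bmeas_prod => i; apply: bL; exact: subordinator_measurable.
- by apply: bmeasM; [exact: bmeas_cst|exact: bmeas_counting hB.1 lt0 z1].
move=> n; have s0 := shifted_time_ge0 n t0.
(* The cell of [B] occupies the index [None], so that the factorization is a single use of the joint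
   independence of the gamma processes and [B]. *)
pose X (o : option 'I_q) w := if o is Some i
  then laplace_char (c i) (Z i (t + lambda^-1 * n%:R) w)
  else (\1_(B (lambda * t) @^-1` [set n]) w)%:C.
transitivity (cexpectation P (fun w => \prod_o X o w)).
  apply: eq_cE => w; rewrite prod_option /X indicE.
  have [/set_mem wn|] := boolP (w \in _); last by rewrite !mul0r.
  by congr (_ * _); apply: eq_bigr => i _; rewrite /gamma_subordinator wn.
rewrite (cE_prod_indep _ (fun A => mutually_independentT hZBind)); last 3 first.
- case=> [i|] A.
    by apply: sigma_process_measurable => s s0'; exact: gamma_measurable.
  by apply: sigma_process_measurable => s s0'; case: hB => -[mBs _ _ _ _] _; exact: mBs.
- by case=> [i|]; [exact: bZ|exact: bmeas_indic].
- case=> [i|]; last first.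
    by apply: fmeas_indic_smallest; apply: (sigma_rv_process lt0); exact: sigma_rv_nat.
  apply: fmeas_sub (sigma_rv_process s0) _.
  by apply: fmeas_comp; exact: bmeas_laplace_char.
rewrite prod_option /X cE_indic//.
transitivity (cexpectation P (fun w =>
    ((\prod_i g i t) * (\prod_i g i lambda^-1) ^+ n) * (\1_(B (lambda * t) @^-1` [set n]) w : R)%:C)).
  rewrite cEZ ?cE_indic//; last exact: bmeas_indic.
  rewrite mulrC; congr (_ * _); rewrite -prodrXl -big_split/=.
  apply: eq_bigr => i _; rewrite -/(g i _) (sg i).1//; last first.
    by rewrite mulr_ge0// invr_ge0 ltW.
  by rewrite mulrC [_^-1 * _]mulrC csemigroupX ?invr_ge0 ?(ltW lambda0)// mulrC.
apply: eq_cE => w; rewrite indicE; have [/set_mem wn|_] := boolP (w \in _).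
  by rewrite mulr1 mul1r wn.
by rewrite mulr0 mul0r.
Qed.

End subordination.

(** Turns convergence of an integer-valued path into eventual equality. *)
Lemma natr_dist_lt1 (R : realType) (m n : nat) : `|m%:R - n%:R : R| < 1 -> m = n.
Proof.
wlog nm : m n / (n <= m)%N => [H|].
  have [nm|/ltnW mn] := leqP n m; first exact: H.
  by rewrite distrC => /(H _ _ mn).
rewrite -natrB// normr_nat ltrn1 ltnS leqn0 subn_eq0 => mn.
by apply/eqP; rewrite eqn_leq mn.
Qed.

(** * Time change by an independent nonnegative process *)

Section time_change.
Context (R : realType) (d : measure_display) (T : measurableType d).
Variable P : probability T R.
Context (q : nat) (k : 'I_q -> nat).
Variables (lam : forall i : 'I_q, 'I_(k i) -> R) (M : 'I_q -> R -> T -> nat).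
Arguments lam : clear implicits.
Variable G : 'I_q -> R -> T -> R.
Hypothesis lam0 : forall (i : 'I_q) (j : 'I_(k i)), 0 <= lam i j.
Hypothesis hM : forall i : 'I_q, generalized_counting_process P (lam i) (M i).
Hypothesis hMind : mutually_independent P
       (fun i : 'I_q => sigma_process (real_process (M i))).
Hypothesis hMG : independent_pair P
       (sigma_processes (fun i : 'I_q => real_process (M i)))
       (sigma_processes G).
Hypothesis mG : forall i t, 0 <= t -> measurable_fun setT (G i t).
Hypothesis G0 : forall i t, 0 <= t -> {ae P, forall w, 0 <= G i t w}.

Lemma levyM i : levy_process P (real_process (M i)).
Proof. by case: (hM i). Qed.

Lemma counting_real_measurable i (t : R) : 0 <= t ->
  measurable_fun setT (real_process (M i) t).
Proof. by case: (levyM i) => mM _ _ _ _; exact: mM. Qed.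

(** Merges the two independence hypotheses, among the counting processes and between them and [G],
    into one product formula at fixed times, with the event of [G] at [None]. *)
Lemma counting_indep (tau : 'I_q -> R) (A : option 'I_q -> set T) :
  (forall i, 0 <= tau i) ->
  (forall o, (if o is Some i then sigma_rv (real_process (M i) (tau i))
              else sigma_processes G) (A o)) ->
  P (\bigcap_o A o) = (\prod_o P (A o))%E.
Proof.
move=> tau0 FA; rewrite bigcap_option prod_option_ereal muleC hMG.
- congr (_ * _)%E; apply: (mutually_independentT hMind) => i.
  exact: (sigma_rv_process (tau0 i) (FA (Some i))).
- apply: sigma_bigcap => i.
  exact: (@sigma_rv_processes _ _ _ _ (fun i => real_process (M i)) i _ (tau0 i) _ (FA (Some i))).
- exact: (FA None).
Qed.

(* [grid_point (grid_index t n w i) n] lies strictly to the right of [G i t w], so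
   that the right continuity of the paths of [M i] applies. *)
Definition grid_index (t : R) (n : nat) (w : T) : {ffun 'I_q -> nat} :=
  [ffun i => Num.trunc (G i t w * n.+1%:R)].

Definition grid_point (m : nat) (n : nat) : R := m.+1%:R / n.+1%:R.

Lemma grid_point_gt0 m n : 0 < grid_point m n.
Proof. by rewrite divr_gt0// ltr0n. Qed.

Lemma grid_index_preimage t n m : grid_index t n @^-1` [set m] =
  \bigcap_(i : 'I_q) (G i t @^-1` ((fun x => Num.trunc (x * n.+1%:R)) @^-1` [set m i])).
Proof.
apply/seteqP; split => [w /= wm i _ /=|w /= wm].
  by rewrite -wm ffunE.
by apply/ffunP => i; rewrite ffunE; exact: wm.
Qed.

Lemma measurable_grid_cell (n k' : nat) :
  measurable ((fun x : R => Num.trunc (x * n.+1%:R)) @^-1` [set k']).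
Proof.
rewrite -[X in measurable X]setTI.
rewrite (_ : _ @^-1` _ = (fun x : R => x * n.+1%:R) @^-1` (@Num.trunc R @^-1` [set k']))//.
by apply: measurable_funM => //; exact: measurable_truncn_level.
Qed.

Lemma grid_index_sigma t n m : 0 <= t ->
  sigma_processes G (grid_index t n @^-1` [set m]).
Proof.
move=> t0; rewrite grid_index_preimage; apply: sigma_bigcap => i.
apply: (sigma_rv_processes t0); exists ((fun x => Num.trunc (x * n.+1%:R)) @^-1` [set m i]).
  exact: measurable_grid_cell.
by rewrite setTI.
Qed.

Lemma grid_index_measurable t n m : 0 <= t ->
  measurable (grid_index t n @^-1` [set m]).
Proof.
move=> t0; apply: (@sigma_processes_measurable _ _ _ _ G) (grid_index_sigma n m t0).
by move=> i s s0; exact: mG.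
Qed.

Lemma grid_point_cvg i t w :
  grid_point (grid_index t n w i) n @[n --> \oo] --> Num.max (G i t w) 0.
Proof.
apply/cvgrPdist_le => e e0; near=> n.
apply: (@le_trans _ _ (n.+1%:R^-1)); last first.
  near: n; have /cvgrPdist_le/(_ _ e0) := @cvg_harmonic R; apply: filterS => n.
  by rewrite sub0r normrN ger0_norm// harmonic_ge0.
rewrite /grid_point ffunE; have n0 : 0 < n.+1%:R :> R by rewrite ltr0n.
have [Y0|Y0] := leP 0 (G i t w).
  have /truncn_itv/andP[] : 0 <= G i t w * n.+1%:R by rewrite mulr_ge0.
  set m := Num.trunc _; rewrite -ler_pdivrMr// -ltr_pdivlMr//.
  rewrite -[m.+1%:R]natr1 mulrDl mul1r; set x := m%:R / _; set y := _^-1; move: x y => x y m1 m2.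
  by rewrite ler_norml; apply/andP; split; lra.
have /truncn0Pn -> : ~~ (1 <= G i t w * n.+1%:R).
  by rewrite -ltNge (@lt_trans _ _ 0)// pmulr_llt0.
by rewrite mul1r sub0r normrN ger0_norm// invr_ge0.
Unshelve. all: by end_near. Qed.

Lemma grid_point_gt i t n w : 0 <= G i t w -> G i t w < grid_point (grid_index t n w i) n.
Proof.
move=> G0w; rewrite /grid_point ffunE ltr_pdivlMr ?ltr0n//.
exact: truncnS_gt.
Qed.

Lemma bmeas_grid (u : 'rV[R[i]]_q) t n : polydisc u -> 0 <= t ->
  bmeas (fun w => \prod_i u 0 i ^+ M i (grid_point (grid_index t n w i) n) w).
Proof.
move=> pu t0; apply: (bmeas_mixture (D := grid_index t n) (c := 1)
    (X := fun m w => \prod_i u 0 i ^+ M i (grid_point (m i) n) w)) => m.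
- exact: grid_index_measurable.
- apply: bmeas_prod => i; apply: bmeas_counting (levyM i) _ (polydisc_nc i pu).
  exact/ltW/grid_point_gt0.
- by move=> w; apply: prod_nc_le1 => i _; apply: nc_exp_le1; exact: polydisc_nc.
Qed.

(** On a cell of [grid_index] the times are deterministic, so [gcp_pgf] applies to each
    component. *)
Lemma cE_time_change_grid (u : 'rV[R[i]]_q) t n : polydisc u -> 0 <= t ->
  cexpectation P (fun w => \prod_i u 0 i ^+ M i (grid_point (grid_index t n w i) n) w) =
  cexpectation P (fun w =>
    \prod_i laplace_char (gcp_exponent lam u i) (grid_point (grid_index t n w i) n)).
Proof.
move=> pu t0; have mD m := grid_index_measurable n m t0.
have bM m i : bmeas (fun w => u 0 i ^+ M i (grid_point m n) w).
  by apply: bmeas_counting (levyM i) _ (polydisc_nc i pu); exact/ltW/grid_point_gt0.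
have Rec i := Re_gcp_exponent_ge0 lam0 i pu.
have bX := bmeas_grid n pu t0.
have bY : bmeas (fun w =>
    \prod_i laplace_char (gcp_exponent lam u i) (grid_point (grid_index t n w i) n)).
  apply: (bmeas_discrete (D := grid_index t n) (c := 1)
    (f := fun m => \prod_i laplace_char (gcp_exponent lam u i) (grid_point (m i) n))) => // m.
  by apply: prod_nc_le1 => i _; exact: nc_laplace_char_le1.
apply: (cE_partition mD bX bY) => m.
have tau0 i : 0 <= grid_point (m i) n by exact/ltW/grid_point_gt0.
pose X (o : option 'I_q) w := if o is Some i
  then u 0 i ^+ M i (grid_point (m i) n) w
  else (\1_(grid_index t n @^-1` [set m]) w)%:C.
transitivity (cexpectation P (fun w => \prod_o X o w)).
  apply: eq_cE => w; rewrite prod_option /X indicE.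
  have [/set_mem wn|] := boolP (w \in _); last by rewrite !mul0r.
  by congr (_ * _); apply: eq_bigr => i _; rewrite wn.
rewrite (cE_prod_indep (F := fun o => if o is Some i
    then sigma_rv (real_process (M i) (grid_point (m i) n)) else sigma_processes G)
  _ (fun A => @counting_indep _ A tau0)); last 3 first.
- case=> [i|] A; last by apply: sigma_processes_measurable => j s; exact: mG.
  by apply: sigma_rv_measurable; exact: counting_real_measurable.
- by case=> [i|]; [exact: bM|apply: bmeas_indic; exact: mD].
- case=> [i|]; last by apply: fmeas_indic_smallest; exact: grid_index_sigma.
  exact: (fmeas_nat (M i (grid_point (m i) n)) (fun j => u 0 i ^+ j)).
rewrite prod_option /X cE_indic; last exact: mD.
transitivity (cexpectation P (fun w =>
    (\prod_i laplace_char (gcp_exponent lam u i) (grid_point (m i) n)) *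
    (\1_(grid_index t n @^-1` [set m]) w : R)%:C)).
  rewrite cEZ ?cE_indic//; last exact: bmeas_indic.
  rewrite mulrC; congr (_ * _); apply: eq_bigr => i _.
  rewrite (gcp_pgf (@lam0 i) (hM i) (polydisc_nc i pu) (tau0 i)).
  by rewrite /laplace_char max_l.
apply: eq_cE => w; rewrite indicE; have [/set_mem wn|_] := boolP (w \in _).
  by rewrite mulr1 mul1r wn.
by rewrite mulr0 mul0r.
Qed.

Lemma cE_time_change (u : 'rV[R[i]]_q) t : polydisc u -> 0 <= t ->
  cexpectation P (fun w => \prod_i u 0 i ^+ M i (G i t w) w) =
  cexpectation P (fun w => \prod_i laplace_char (gcp_exponent lam u i) (G i t w)).
Proof.
move=> pu t0; have Rec i := Re_gcp_exponent_ge0 lam0 i pu.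
pose Yn n w := \prod_i u 0 i ^+ M i (grid_point (grid_index t n w i) n) w.
pose Y w := \prod_i u 0 i ^+ M i (G i t w) w.
have [N [mN N0 goodN]] : {ae P, forall w, forall i, 0 <= G i t w /\ cadlag (real_process (M i) ^~ w)}.
  apply: filter_forall => i; have [_ [_ cM] _ _ _] := levyM i.
  by apply: filterS2 (G0 i t0) cM => w.
have good w : ~ N w -> forall i, 0 <= G i t w /\ cadlag (real_process (M i) ^~ w).
  by move=> Nw; apply: contrapT => H; apply: Nw; exact: goodN.
have mNC : measurable (~` N) by exact: measurableC.
(* Multiplying by this indicator changes no expectation, makes the convergence hold at every
   outcome, and so makes the limit measurable. *)
have offN (V : T -> R[i]) : cexpectation P (fun w => (\1_(~` N) w)%:C * V w) = cexpectation P V.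
  apply: cE_ae; exists N; split => // w /= /eqP Vw; apply: contrapT => Nw.
  by move/eqP : Vw; apply; rewrite indicE mem_set// mul1r.
have bYn n : bmeas (Yn n) by exact: bmeas_grid.
have bI : bmeas (fun w => (\1_(~` N) w : R)%:C) by exact: bmeas_indic.
have Yc w : ccvg \oo (fun n => (\1_(~` N) w)%:C * Yn n w) ((\1_(~` N) w)%:C * Y w).
  rewrite indicE; have [/set_mem Nw|_] := boolP (w \in ~` N); last first.
    by apply: ccvg_near; apply: nearW => n; rewrite !mul0r.
  apply: ccvgM; first exact: ccvg_cst.
  apply: ccvg_prod => i; have [Gi [cM _]] := good w Nw i.
  (* Right continuity of an integer-valued path makes it constant just after [G i t w]; the grid
     times approach that point from strictly above, so the powers agree eventually. *)
  apply: ccvg_near.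
  have tau_gt n : G i t w < grid_point (grid_index t n w i) n by exact: grid_point_gt.
  have tau_cvg : grid_point (grid_index t n w i) n @[n --> \oo] --> G i t w.
    by have := @grid_point_cvg i t w; rewrite max_l.
  have /cvg_at_rightP/(_ _ (conj tau_gt tau_cvg))/cvgrPdist_lt/(_ _ ltr01) := cM _ Gi.
  apply: filterS => n /=; rewrite /real_process => MG.
  by rewrite (natr_dist_lt1 MG).
have c1 : ccvg \oo (fun n => cexpectation P (Yn n)) (cexpectation P Y).
  rewrite -offN.
  under eq_fun do rewrite -offN.
  apply: (cE_cvg P (c := 1)) => [n|n w|//]; first exact: bmeasM.
  rewrite ncM mulr_ile1 ?nc_ge0//.
    by rewrite nc_real indicE; case: (_ \in _); rewrite ?normr1 ?normr0.
  by apply: prod_nc_le1 => i _; apply: nc_exp_le1; exact: polydisc_nc.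
apply: (ccvg_unique c1).
have c2 : ccvg \oo (fun n => cexpectation P (fun w =>
      \prod_i laplace_char (gcp_exponent lam u i) (grid_point (grid_index t n w i) n)))
    (cexpectation P (fun w => \prod_i laplace_char (gcp_exponent lam u i) (G i t w))).
  apply: (cE_cvg P (c := 1)) => [n|n w|w].
  - apply: (bmeas_discrete (D := grid_index t n) (c := 1)
      (f := fun m => \prod_i laplace_char (gcp_exponent lam u i) (grid_point (m i) n))) => m.
      exact: grid_index_measurable.
    by apply: prod_nc_le1 => i _; exact: nc_laplace_char_le1.
  - by apply: prod_nc_le1 => i _; exact: nc_laplace_char_le1.
  - apply: ccvg_prod => i.
    have -> : laplace_char (gcp_exponent lam u i) (G i t w) =
        laplace_char (gcp_exponent lam u i) (Num.max (G i t w) 0).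
      by rewrite /laplace_char [in RHS]max_l// le_max lexx orbT.
    by apply: ccvg_laplace_char; [exact: ccvg_cst|exact: grid_point_cvg].
apply: (ccvg_near_eq _ c2); apply: nearW => n.
by rewrite cE_time_change_grid.
Unshelve. all: by end_near. Qed.

End time_change.

(** At time 1 the coefficient n + s - 1 over n is n over n, so the negative binomial law is
    geometric. *)
Lemma gbinomnn (R : realType) (n : nat) : gbinom (n%:R : R) n = 1.
Proof.
rewrite /gbinom -ffactnn ffact_prod natr_prod.
have -> : \prod_(i < n) (n%:R - i%:R) = \prod_(i < n) ((n - i)%N%:R) :> R.
  by apply: eq_bigr => i _; rewrite natrB// ltnW.
apply: divff; apply/prodf_neq0 => i _.
by rewrite pnatr_eq0 subn_eq0 -ltnNge.
Qed.

(** * The generating function *)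

Section segment.
Context (R : realType) (q : nat).

(** Extends the unit segment to a path over the whole line, so that continuity along it is tested on
    all real sequences. *)
Definition clamp (x : R) : R := Num.min (Num.max x 0) 1.

Lemma clamp_ge0 x : 0 <= clamp x.
Proof. by rewrite /clamp le_min le_max lexx orbT ler01. Qed.

Lemma clamp_le1 x : clamp x <= 1.
Proof. by rewrite /clamp ge_min lexx orbT. Qed.

Lemma clamp0 : clamp 0 = 0.
Proof. by rewrite /clamp max_l// min_l. Qed.

Lemma clamp1 : clamp 1 = 1.
Proof. by rewrite /clamp max_l// min_l. Qed.

Lemma cvg_clamp (x : nat -> R) (l : R) : x n @[n --> \oo] --> l ->
  clamp (x n) @[n --> \oo] --> clamp l.
Proof.
move=> xl; rewrite /clamp.
have ml : Num.max (x n) 0 @[n --> \oo] --> Num.max l 0.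
  rewrite maxr_absE; under eq_fun do rewrite maxr_absE.
  apply: cvgM; last exact: cvg_cst.
  apply: cvgD; first by apply: cvgD => //; exact: cvg_cst.
  by apply: cvg_norm; apply: cvgB => //; exact: cvg_cst.
rewrite minr_absE; under eq_fun do rewrite minr_absE.
apply: cvgM; last exact: cvg_cst.
apply: cvgB; first by apply: cvgD => //; exact: cvg_cst.
by apply: cvg_norm; apply: cvgB => //; exact: cvg_cst.
Qed.

Definition segment (u : 'rV[R[i]]_q) (x : R) : 'rV[R[i]]_q :=
  \row_i (1 + (clamp x)%:C * (u 0 i - 1)).

Lemma segment0 u : segment u 0 = const_mx 1.
Proof. by apply/rowP => i; rewrite !mxE clamp0 mul0r addr0. Qed.

Lemma segment1 u : segment u 1 = u.
Proof. by apply/rowP => i; rewrite !mxE clamp1 mul1r addrC subrK. Qed.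

Lemma polydisc_segment u x : polydisc u -> polydisc (segment u x).
Proof.
move=> pu i; rewrite norm_nc lecR mxE.
have -> : 1 + (clamp x)%:C * (u 0 i - 1) = (1 - clamp x)%:C + (clamp x)%:C * u 0 i.
  by rewrite rmorphB /=; ring.
rewrite (le_trans (ler_ncD _ _))// ncM !nc_real !ger0_norm ?clamp_ge0 ?subr_ge0 ?clamp_le1//.
have := ler_wpM2l (clamp_ge0 x) (polydisc_nc i pu).
by rewrite mulr1; lra.
Qed.

Lemma ccvg_segment u (x : nat -> R) (l : R) i : x n @[n --> \oo] --> l ->
  ccvg \oo (fun n => segment u (x n) 0 i) (segment u l 0 i).
Proof.
move=> xl; rewrite mxE; under eq_fun do rewrite mxE.
apply: ccvgD; first exact: ccvg_cst.
by apply: ccvgM; [apply: ccvg_real; exact: cvg_clamp|exact: ccvg_cst].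
Qed.

(** The values are 1 or -1, and the real part is continuous: a change of sign would produce a zero
    by the intermediate value theorem. Sequential continuity is the form that dominated convergence
    delivers. *)
Lemma sqr1_continuous_const (f : R -> R[i]) :
  (forall x : nat -> R, forall l, x n @[n --> \oo] --> l ->
    ccvg \oo (fun n => f (x n)) (f l)) ->
  f 0 = 1 -> (forall x, f x ^+ 2 = 1) -> f 1 = 1.
Proof.
move=> cf f0 f2; have /eqP := f2 1; rewrite sqrf_eq1 => /predU1P[//|/eqP f1].
have cRe : continuous (fun x => complex.Re (f x)).
  by move=> x; apply/(@cvg_nbhsP _ R^o) => y /cf [].
have [|x _ fx] := IVT ler01 (continuous_subspaceT cRe) (_ : _ <= 0 <= _).
  by rewrite f0 f1 /= ge_min le_max; lra.
have /eqP := f2 x; rewrite sqrf_eq1 => /orP[] /eqP E; move: fx; rewrite E /= => /eqP.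
  by rewrite oner_eq0.
by rewrite oppr_eq0 oner_eq0.
Qed.

End segment.

(** * The subordinated generating function as a power of w *)

Section main.
Context (R : realType) (d : measure_display) (T : measurableType d).
Variable P : probability T R.
Context (q : nat) (k : 'I_q -> nat).
Variables (lam : forall i : 'I_q, 'I_(k i) -> R) (lambda theta : R) (a : 'I_q -> R).
Arguments lam : clear implicits.
Variables (Z : 'I_q -> R -> T -> R) (B : R -> T -> nat).
Hypothesis lam0 : forall (i : 'I_q) (j : 'I_(k i)), 0 <= lam i j.
Hypothesis lambda0 : 0 < lambda.
Hypothesis theta01 : 0 < theta < 1.
Hypothesis a0 : forall i, 0 < a i.
Hypothesis hZ : forall i, gamma_process P lambda (a i) (Z i).
Hypothesis hB : negative_binomial_process P theta B.
Hypothesis hZBind : mutually_independent P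
       (fun o : option 'I_q =>
          if o is Some i then sigma_process (Z i)
          else sigma_process (real_process B)).
Local Notation G := (gamma_subordinator lambda Z B).
Implicit Types u : 'rV[R[i]]_q.

Let gam u i s := cexpectation P (fun w => laplace_char (gcp_exponent lam u i) (Z i s w)).

Definition subordinated_pgf u (t : R) : R[i] :=
  cexpectation P (fun w => \prod_i laplace_char (gcp_exponent lam u i) (G i t w)).

Let lambdaV_ge0 : 0 <= lambda^-1. Proof. by rewrite invr_ge0 ltW. Qed.

Let nc_gam u : polydisc u -> nc (\prod_i gam u i lambda^-1) <= 1.
Proof.
move=> pu; apply: prod_nc_le1 => i _; apply: ler_nc_cE_cst.
  apply: bmeas_comp; first exact: (gamma_measurable hZ).
  exact/bmeas_laplace_char/Re_gcp_exponent_ge0.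
by move=> w; exact/nc_laplace_char_le1/Re_gcp_exponent_ge0.
Qed.

Lemma subordinated_pgfE u t : polydisc u -> 0 <= t -> subordinated_pgf u t =
  (\prod_i gam u i t) * cexpectation P (fun w => (\prod_i gam u i lambda^-1) ^+ B (lambda * t) w).
Proof.
move=> pu t0; apply: (cE_subordinator lambda0 hZ hB hZBind) => // i.
exact: Re_gcp_exponent_ge0.
Qed.

(** The clock s = lambda t: the gamma shapes and the index of the negative binomial law all equal s,
    so they reach 1 together. *)
Let pgf_semigroup u s := (\prod_i gam u i (lambda^-1 * s)) *
  cexpectation P (fun w => (\prod_i gam u i lambda^-1) ^+ B s w).

Let csemigroup_pgf u : polydisc u -> csemigroup (pgf_semigroup u).
Proof.
move=> pu; apply: csemigroupM; last exact: counting_csemigroup hB.1 (nc_gam pu).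
apply: csemigroup_prod => i; apply: (csemigroup_scale (f := gam u i)).
  by rewrite invr_gt0.
apply: gamma_csemigroup (hZ i) _; exact: Re_gcp_exponent_ge0.
Qed.

Let pgf_semigroupE u t : polydisc u -> 0 <= t ->
  pgf_semigroup u (lambda * t) = subordinated_pgf u t.
Proof.
by move=> pu t0; rewrite subordinated_pgfE// /pgf_semigroup mulKf// gt_eqF.
Qed.

Lemma gamma_factor u i : polydisc u -> gam u i lambda^-1 * pgf_factor lam a u i = 1.
Proof.
move=> pu; have aC : (a i)%:C != 0 by rewrite -nc_eq0 nc_real normr_eq0 gt_eqF.
apply: (mulfI aC); rewrite mulr1 mulrCA pgf_factorE//.
apply: cE_exponential => //.
- exact: (gamma_measurable hZ).
- exact: Re_gcp_exponent_ge0.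
- move=> x x0; have [_ lawZ] := hZ i.
  by rewrite lawZ ?invr_gt0// divff ?gt_eqF// gamma_pdf1_lt.
Qed.

Let pgf_semigroup1 u : polydisc u -> pgf_semigroup u 1 = pgf_base lam theta a u.
Proof.
move=> pu; have [t0 t1] := andP theta01.
have prodV : \prod_i gam u i lambda^-1 = (\prod_i pgf_factor lam a u i)^-1.
  rewrite -prodfV; apply: eq_bigr => i _.
  apply: (mulIf (pgf_factor_neq0 lam0 a0 i pu)).
  by rewrite gamma_factor// mulVf// pgf_factor_neq0.
have B1 n : P (B 1 @^-1` [set n]) = ((1 - theta) * theta ^+ n)%:E.
  by have [_ /(_ 1 n ler01)] := hB; rewrite addrK gbinomnn mulr1 powRr1 ?subr_ge0 ?ltW//.
have geo := cE_geometric (P := P) _ (nc_gam pu) _ B1.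
(* The product of transforms has modulus at most 1 and [theta] is below 1, so the geometric identity
   can be cancelled against [pgf_baseE]. *)
have W0 : 1 - theta%:C * \prod_i gam u i lambda^-1 != 0.
  apply/eqP => /eqP; rewrite subr_eq0 => /eqP E.
  have : nc (theta%:C * \prod_i gam u i lambda^-1) < 1.
    by rewrite ncM nc_real gtr0_norm// (le_lt_trans _ t1)// ler_piMr ?nc_gam// ltW.
  by rewrite -E nc1 ltxx.
apply: (mulIf W0); rewrite [in RHS]prodV (pgf_baseE lam0 theta01 a0 pu) /pgf_semigroup.
rewrite mulr1 -mulrA geo.
- by rewrite prodV mulrC.
- by rewrite ltW.
- move=> n; exact: counting_measurable hB.1 ler01.
Qed.

Lemma subordinated_pgf_const1 t : 0 <= t -> subordinated_pgf (const_mx 1) t = 1.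
Proof.
move=> t0; rewrite /subordinated_pgf -[RHS](cE_cst P); apply: eq_cE => w.
apply: big1 => i _; rewrite /gcp_exponent big1 => [|j _].
  by rewrite /laplace_char mulr0 oppr0 cexp0.
by rewrite mxE expr1n subrr mulr0.
Qed.

(** Supplies the continuity in u along segments that rules out a change of sign of the square
    root. *)
Lemma ccvg_subordinated_pgf (v : nat -> 'rV[R[i]]_q) u t :
  (forall n, polydisc (v n)) -> 0 <= t ->
  (forall i, ccvg \oo (fun n => v n 0 i) (u 0 i)) ->
  ccvg \oo (fun n => subordinated_pgf (v n) t) (subordinated_pgf u t).
Proof.
move=> pv t0 vu; apply: (cE_cvg P (c := 1)) => [n|n w|w].
- apply: bmeas_prod => i; apply: bmeas_comp.
    exact: (subordinator_measurable lambda0 hZ hB).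
  exact/bmeas_laplace_char/Re_gcp_exponent_ge0.
- by apply: prod_nc_le1 => i _; exact/nc_laplace_char_le1/Re_gcp_exponent_ge0.
- apply: ccvg_prod => i; apply: ccvg_laplace_char; last exact: cvg_cst.
  exact: ccvg_gcp_exponent.
Qed.

Lemma subordinated_pgf_cexp (L : 'rV[R[i]]_q -> R[i]) u t :
  continuous_log (pgf_base lam theta a) L -> polydisc u -> 0 <= t ->
  subordinated_pgf u t = cexp ((lambda * t)%:C * L u).
Proof.
move=> cL; have [_ Lw L1] := cL.
pose r v s := pgf_semigroup v s * cexp (s%:C * - L v).
have sr v : polydisc v -> csemigroup (r v).
  by move=> pv; apply: csemigroupM; [exact: csemigroup_pgf|exact: csemigroup_cexp].
have r1 v : polydisc v -> r v 1 = 1.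
  move=> pv; rewrite /r pgf_semigroup1// -Lw// mul1r cexpN divff//.
  exact: cexp_neq0.
have r_const1 s : 0 <= s -> r (const_mx 1) s = 1.
  move=> s0; rewrite /r L1 oppr0 mulr0 cexp0 mulr1.
  rewrite -[s](mulVKf (lt0r_neq0 lambda0)) pgf_semigroupE ?subordinated_pgf_const1//.
  - by rewrite mulr_ge0.
  - by move=> i; rewrite mxE normr1.
  - by rewrite mulr_ge0.
(* On each segment from (1, ..., 1), [r _ (2 ^- n.+1)] is a continuous square
   root of [r _ (2 ^- n)], hence of 1 by induction. *)
have r_dyadic n : forall v, polydisc v -> r v (2 ^- n) = 1.
  elim: n => [v pv|n IH v pv]; first by rewrite expr0 invr1 r1.
  have s0 : 0 <= 2 ^- n.+1 :> R by rewrite invr_ge0 exprn_ge0.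
  rewrite -(segment1 v); apply: (sqr1_continuous_const (f := fun x => r (segment v x) (2 ^- n.+1))).
  - move=> x l xl; apply: ccvgM.
      rewrite -[2 ^- n.+1](mulVKf (lt0r_neq0 lambda0)).
      rewrite pgf_semigroupE ?mulr_ge0//; last exact: polydisc_segment.
      under eq_fun => m do rewrite (pgf_semigroupE (polydisc_segment (x m) pv) (mulr_ge0 lambdaV_ge0 s0)).
      apply: ccvg_subordinated_pgf => [m||i].
      + exact: polydisc_segment.
      + by rewrite mulr_ge0.
      + exact: ccvg_segment.
    apply: ccvg_cexp; apply: ccvgM; first exact: ccvg_cst.
    apply: ccvgN; apply: (ccvg_continuous_log cL) => [m||i].
    + exact: polydisc_segment.
    + exact: polydisc_segment.
    + exact: ccvg_segment.
  - by rewrite segment0 r_const1.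
  - move=> x; have px := polydisc_segment x pv.
    rewrite expr2 -(sr _ px).1// -(IH _ px); congr (r _ _).
    by rewrite exprS; field; rewrite expf_neq0.
move=> pu t0; have lt0 : 0 <= lambda * t by rewrite mulr_ge0// ltW.
have := csemigroup_dyadic (sr u pu) (fun n => r_dyadic n u pu) lt0.
rewrite /r pgf_semigroupE// mulrN cexpN => /(congr1 (fun z => z * cexp ((lambda * t)%:C * L u))).
by rewrite mulfVK ?cexp_neq0// mul1r.
Qed.

End main.
Unset Implicit Arguments.
Unset Strict Implicit.

Theorem proposition4p2 (R : realType) (d : measure_display)
    (T : measurableType d) (P : probability T R)
    (q : nat) (k : 'I_q -> nat) (lam : forall i : 'I_q, 'I_(k i) -> R)
    (lambda theta : R) (a : 'I_q -> R)
    (M : 'I_q -> R -> T -> nat) (Z : 'I_q -> R -> T -> R) (B : R -> T -> nat)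
    (hlam : forall (i : 'I_q) (j : 'I_(k i)), 0 < lam i j)
    (hlambda : 0 < lambda)
    (htheta : 0 < theta < 1)
    (ha : forall i : 'I_q, 0 < a i)
    (hM : forall i : 'I_q, generalized_counting_process P (lam i) (M i))
    (hMind : mutually_independent P
       (fun i : 'I_q => sigma_process (real_process (M i))))
    (hZ : forall i : 'I_q, gamma_process P lambda (a i) (Z i))
    (hB : negative_binomial_process P theta B)
    (hZBind : mutually_independent P
       (fun o : option 'I_q =>
          if o is Some i then sigma_process (Z i)
          else sigma_process (real_process B)))
    (hMG : independent_pair P
       (sigma_processes (fun i : 'I_q => real_process (M i)))
       (sigma_processes (gamma_subordinator lambda Z B))) :
  (exists L : 'rV[R[i]]_q -> R[i], continuous_log (pgf_base lam theta a) L) /\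
  forall L : 'rV[R[i]]_q -> R[i], continuous_log (pgf_base lam theta a) L ->
  forall (u : 'rV[R[i]]_q) (t : R), (forall i : 'I_q, `|u 0 i| <= 1) -> 0 <= t ->
    cexpectation P (fun w =>
      \prod_(i < q) u 0 i ^+ M i (gamma_subordinator lambda Z B i t w) w) =
    cexp ((lambda * t)%:C * L u).
Proof.
have lam0 i j : 0 <= lam i j by exact: ltW.
split; first exact: continuous_log_pgf_base.
move=> L cL u t u1 t0.
rewrite (cE_time_change lam0 hM hMind hMG)//.
- by apply: (subordinated_pgf_cexp lam0 hlambda htheta ha hZ hB hZBind cL).
- by move=> i s; exact: (subordinator_measurable hlambda hZ hB).
- by move=> i s; exact: (subordinator_ge0 B hlambda hZ).
Qed.
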